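(* Let $X=(X_t)_{t\ge 0}$ be a recurrent diffusion process on $\mathbb R$ started at $X_0=0$ under a probability measure $\mathsf P$, and let $\mu$ be a probability measure on $(\mathbb R,\mathcal B(\mathbb R))$ such that $\mu(\{0\})=0$. (I) If $\operatorname{supp}(\mu)\subseteq\mathbb R_+$, then there exists a left-continuous increasing function $b:(0,\infty)\to\mathbb R$ such that $X_{\tau_b}\sim\mu$, where $\tau_b=\inf\{t>0 : X_t\ge b(t)\}$. (II) If $\operatorname{supp}(\mu)\subseteq\mathbb R_-$, then there exists a left-continuous decreasing function $c:(0,\infty)\to\mathbb R$ such that $X_{\tau_c}\sim\mu$, where $\tau_c=\inf\{t>0 : X_t\le c(t)\}$. (III) If $\operatorname{supp}(\mu)\cap\mathbb R_+\ne\varnothing$ and $\operatorname{supp}(\mu)\cap\mathbb R_-\ne\varnothing$, then there exist a left-continuous increasing function $b:(0,\infty)\to\mathbb R\cup\{+\infty\}$ and a left-continuous decreasing function $c:(0,\infty)\to\mathbb R\cup\{-\infty\}$ such that $X_{\tau_{b,c}}\sim\mu$, where $\tau_{b,c}=\inf\{t>0 : X_t\ge b(t)\text{ or }X_t\le c(t)\}$.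
   Context: $\mathbb R_+=[0,\infty)$ and $\mathbb R_-=(-\infty,0]$. $\operatorname{supp}(\mu)$ is the (closed) topological support of $\mu$. ''Increasing'' and ''decreasing'' are meant in the weak sense (non-decreasing, non-increasing). For a random time $\tau$, $X_\tau\sim\mu$ means that $\tau<\infty$ almost surely and the law of $X_\tau$ is $\mu$. A diffusion process on $\mathbb R$ is understood in the sense of Itô and McKean: a time-homogeneous strong Markov process with state space $\mathbb R$ and continuous sample paths; $\mathsf P_x$ denotes the law under which it starts at $x$ (so $\mathsf P=\mathsf P_0$). It is recurrent if $\mathsf P_x(\tau_y<\infty)=1$ for all $x,y\in\mathbb R$, where $\tau_y=\inf\{t>0 : X_t=y\}$; recurrent diffusions are in particular regular. *)

(* Defs.v *)
From HB Require Import structures.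
From mathcomp Require Import all_boot all_order all_algebra.
From mathcomp Require Import all_classical all_reals all_analysis.
From mathcomp Require Import measurable_realfun.

Set Implicit Arguments.
Unset Strict Implicit.
Unset Printing Implicit Defensive.

Import Order.TTheory GRing.Theory Num.Theory.
Import numFieldNormedType.Exports.

Local Open Scope classical_set_scope.
Local Open Scope ring_scope.

(* The time set [0, +oo[ is encoded by quantifying
   over t : R with 0 <= t: a process is a map X : R -> T -> R whose values at
   negative times are never used. *)

Section processes.
Context {d : measure_display} {T : measurableType d} {R : realType}.
Implicit Types (P : probability T R) (X : R -> T -> R) (tau : T -> \bar R)
  (mu : probability (measurableTypeR R) R).

(* The sigma-algebra sigma(X_s : 0 <= s <= t). *)
Definition natural_filtration X (t : R) : set (set T) :=
  <<s [set E | exists s (A : set (measurableTypeR R)),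
         [/\ 0 <= s <= t, measurable A & E = X s @^-1` A] ]>>.

(* Product sigma-algebra on paths; coordinates at negative times are left out. *)
Definition path_measurable : set (set (R -> R)) :=
  <<s [set B | exists s (A : set (measurableTypeR R)),
         [/\ 0 <= s, measurable A & B = [set w | A (w s)] ] ]>>.

(* Strict inequality, following Ito and McKean: these are the stopping times of
   the right-continuous filtration (F_(t+)). *)
Definition markov_time X tau : Prop :=
  (forall w, (0 <= tau w)%E) /\
  forall t, 0 <= t -> natural_filtration X t [set w | (tau w < t%:E)%E].

(* The events G of F_(tau+). *)
Definition prior_event X tau (G : set T) : Prop :=
  forall t, 0 <= t ->
    natural_filtration X t (G `&` [set w | (tau w < t%:E)%E]).

Definition finite_time tau : set T := [set w | (tau w < +oo)%E].

(* X_tau, meaningful on [finite_time tau] only. *)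
Definition stopped X tau (w : T) : R := X (fine (tau w)) w.

(* [P x] is the law under which the process starts at x; the family is
   time-homogeneous because the same [P] serves at every restart.  The field
   [diffusion_strong_markov] is the integrated form of
   P_x(X_(tau + .) \in B | F_(tau+)) = P_(X_tau)(X \in B)
   P_x-a.s. on {tau < +oo}. *)
Record diffusion (P : R -> probability T R) X : Prop := Diffusion {
  diffusion_measurable : forall t, 0 <= t ->
    measurable_fun setT (X t : T -> measurableTypeR R) ;
  diffusion_continuous : forall w, {within `[0, +oo[, continuous (X ^~ w)} ;
  diffusion_start : forall x, P x [set w | X 0 w = x] = 1%E ;
  diffusion_kernel : forall B, path_measurable B ->
    measurable_fun [set: measurableTypeR R]
      (fun x => P x [set w | B (X ^~ w)]) ;
  diffusion_strong_markov : forall x tau G B,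
    markov_time X tau -> prior_event X tau G -> path_measurable B ->
    P x (G `&` finite_time tau `&`
         [set w | B (fun s => X (fine (tau w) + s) w)]) =
    (\int[P x]_(w in G `&` finite_time tau)
       P (stopped X tau w) [set w' | B (X ^~ w')])%E }.

(* inf {t > 0 | D t X_t}, equal to +oo when there is no such t. *)
Definition first_time X (D : R -> R -> Prop) (w : T) : \bar R :=
  ereal_inf [set t%:E | t in [set t | 0 < t /\ D t (X t w)]].

Definition recurrent (P : R -> probability T R) X : Prop :=
  forall x y, P x (finite_time (first_time X (fun _ z => z = y))) = 1%E.

Definition stopped_law P X tau mu : Prop :=
  {ae P, forall w, (tau w < +oo)%E} /\
  forall A : set (measurableTypeR R), measurable A ->
    measurable (finite_time tau `&` stopped X tau @^-1` A) /\
    P (finite_time tau `&` stopped X tau @^-1` A) = mu A.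

Definition topological_support mu : set R :=
  [set x | forall U : set R, open U -> U x -> (0 < mu U)%E].

(* Functions on ]0, +oo[ are given by maps on R, restricted to ]0, +oo[;
   monotonicity is weak. *)
Definition left_continuous (V : topologicalType) (f : R -> V) : Prop :=
  forall t, 0 < t -> f s @[s --> t^'-] --> f t.

Definition increasing disp (V : porderType disp) (f : R -> V) : Prop :=
  {in `]0, +oo[ &, nondecreasing_fun f}.

Definition decreasing disp (V : porderType disp) (f : R -> V) : Prop :=
  {in `]0, +oo[ &, nonincreasing_fun f}.

End processes.

(* Main.v *)
Require Import Defs.
From mathcomp Require Import all_boot all_order all_algebra.
From mathcomp Require Import all_classical all_reals all_analysis.
From mathcomp Require Import measurable_realfun lra.

Set Implicit Arguments.
Unset Strict Implicit.
Unset Printing Implicit Defensive.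

Import Order.TTheory GRing.Theory Num.Theory.
Import numFieldNormedType.Exports.

Local Open Scope classical_set_scope.
Local Open Scope ring_scope.

(** The stopping regions shrink with time.  They are described by pairs of
    barriers: closed sets of points (t, x), x >= 0, stable under decreasing t
    and under increasing x, one for each side of the origin.  Their boundaries
    are the left-continuous monotone functions of the statement.

    Two consequences of the strong Markov property replace any knowledge of the
    transition law, so that diffusions with sticky points are covered.  First,
    started at any point, the path visits both sides of it immediately
    ([prob_crosses]).  Secondly, anticipating the shrinking of the region by a
    small time does not change much the time at which it is hit
    ([delayed_hit_as]): at a short return time T to 0 the process starts afresh
    with a region that is T units of time older.  Together they show that the
    path is in the interior of the region as soon as it has hit it
    ([enters_as]).  Points of the interior are stable under perturbation, and
    points outside are so because the region is closed; hence the hitting time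
    and the stopping position depend continuously on the region, as long as the
    stopping position does not approach 0 ([hit_limit_gt],
    [hit_limit_stopped]).

    For finitely many prescribed masses p i at points different from 0, keep
    the i-th point active up to a time a i ([levels]).  Among the durations for
    which no point receives more than p i, choose some with the largest sum.
    Prolonging one duration adds mass continuously to its point and can only
    take mass from the other points, so a point that receives too little would
    contradict maximality ([sub_embedding]).

    For general [mu], discretise on finer and finer grids ([mesh_embedding]) and
    extract a convergent sequence of barriers ([barrier_selection]).  Tightness
    of [mu] prevents stopping times from escaping to infinity
    ([limit_finite]), the absence of mass at 0 prevents stopping positions from
    collapsing to 0 ([limit_open_le]), and the limiting region embeds [mu].

    When [mu] lives on one side, only the barrier of that side is present, and
    its boundary is finite at all times: the process can return to 0 before
    stopping, and repeat this, so that with positive probability it has not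
    stopped at any given time ([nohit_gt0]). *)

(** * Continuous paths and hitting times *)

Section continuous_paths.
Context {R : realType}.
Implicit Types (f : R -> R) (D : R -> R -> Prop) (J : set R) (E : set (R -> R)).

(** Continuity on the half-line of times: the values at negative times are
    arbitrary and are left out of every neighbourhood. *)
Definition cpath f := forall t, 0 <= t ->
  forall U, nbhs (f t) U -> \forall s \near t, 0 <= s -> U (f s).

Lemma within_cpath f : {within `[0, +oo[, continuous f} -> cpath f.
Proof.
move=> /subspace_continuousP cf t t0 U fU.
have {}t0 : [set` `[0, +oo[] t by rewrite /= in_itv /= andbT.
have h : \forall s \near t, `[0, +oo[%classic s -> U (f s) by exact: (cf t t0 U fU).
by apply: filterS h => s /[swap] s0; apply; rewrite /= in_itv /= andbT.
Qed.

Lemma cpath_shift f a : 0 <= a -> cpath f -> cpath (fun s => f (a + s)).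
Proof.
move=> a0 cf t t0 U fU.
have := cf (a + t) (addr_ge0 a0 t0) U fU => N.
have c : (fun s : R => a + s) @ t --> a + t by apply: cvgD; [exact: cvg_cst|].
have : \forall s \near t, 0 <= a + s -> U (f (a + s)) by exact: c N.
by apply: filterS => s + s0; apply; exact: addr_ge0.
Qed.

Definition coordinate_events J : set (set (R -> R)) :=
  <<s [set B | exists s (A : set (measurableTypeR R)),
         [/\ J s, measurable A & B = [set w | A (w s)] ] ]>>.

(** The sigma-algebra generated by the coordinates only sees countably many
    times, so events about whole trajectories, such as hitting a region, do not
    belong to it.  It is enough that they have the same continuous members as
    some event that does. *)
Definition observed J E := exists2 B, coordinate_events J B &
  forall f, cpath f -> (E f <-> B f).

Lemma observed_coord J s (A : set (measurableTypeR R)) :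
  J s -> measurable A -> observed J [set f | A (f s)].
Proof.
move=> Js mA; exists [set f | A (f s)] => //.
by apply: sub_sigma_algebra; exists s, A.
Qed.

Lemma observed_eq J E E' : (forall f, cpath f -> (E f <-> E' f)) ->
  observed J E' -> observed J E.
Proof.
move=> EE' [B mB EB]; exists B => // f cf.
by split => [/(EE' f cf)/(EB f cf)//|/(EB f cf)/(EE' f cf)].
Qed.

Lemma observed_sub J J' E : J `<=` J' -> observed J E -> observed J' E.
Proof.
move=> JJ' [B mB EB]; exists B => //; move: B mB {EB}.
apply: sub_sigma_algebra2 => _ [s [A [Js mA ->]]]; exists s, A.
by split => //; exact: JJ'.
Qed.

Lemma observed0 J : observed J set0.
Proof. by exists set0; [exact: sigma_algebra0|]. Qed.

Lemma observedC J E : observed J E -> observed J (~` E).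
Proof.
move=> [B mB EB]; exists (~` B).
  by rewrite -setTD; exact: sigma_algebraCD.
by move=> f cf; split => nE /(EB f cf).
Qed.

Lemma observed_exists J (I : countType) (E : I -> set (R -> R)) :
  (forall i, observed J (E i)) -> observed J [set f | exists i, E i f].
Proof.
move=> /(_ _)/cid2 - /all_sig2[B mB EB].
pose C n := if unpickle n is Some i then B i else set0.
exists (\bigcup_n C n).
  apply: sigma_algebra_bigcup => n; rewrite /C.
  by case: unpickle => [i|]; [exact: mB|exact: sigma_algebra0].
move=> f cf; split => [[i Ei]|[n _]].
  by exists (pickle i) => //; rewrite /C pickleK; apply/(EB i f cf).
by rewrite /C; case: unpickle => // i /(EB i f cf) Ei; exists i.
Qed.

Lemma observed_forall J (I : countType) (E : I -> set (R -> R)) :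
  (forall i, observed J (E i)) -> observed J [set f | forall i, E i f].
Proof.
move=> oE; apply: (@observed_eq _ _ (~` [set f | exists i, (~` E i) f])).
  move=> f cf; split => [Ei [i]|nE i]; first by apply; exact: Ei.
  by apply: contrapT => nEi; apply: nE; exists i.
by apply: observedC; apply: observed_exists => i; exact: observedC.
Qed.

Lemma observedI J E E' : observed J E -> observed J E' -> observed J (E `&` E').
Proof.
move=> oE oE'.
apply: (@observed_eq _ _ [set f | forall b : bool, (if b then E else E') f]).
  move=> f cf; split => [[] ? ? []//|EE'].
  by split; [exact: (EE' true)|exact: (EE' false)].
by apply: observed_forall => -[].
Qed.

Lemma observed_imply J (Q : Prop) E : observed J E ->
  observed J [set f | Q -> E f].
Proof.
move=> oE; have [q|nq] := pselect Q.
  by apply: observed_eq oE => f cf; split => [/(_ q)|Ef _].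
apply: (@observed_eq _ _ (~` set0)); last exact/observedC/observed0.
by move=> f cf; split => [_ []|_ q]; case: (nq q).
Qed.

Lemma observed_and J (Q : Prop) E : (Q -> observed J E) ->
  observed J [set f | Q /\ E f].
Proof.
move=> oE; have [q|nq] := pselect Q.
  by apply: observed_eq (oE q) => f cf; split => [[]|].
by apply: observed_eq (observed0 J) => f cf; split => [[/nq]|[]].
Qed.

Lemma observed_lt J s t : J s -> J t -> observed J [set f | f s < f t].
Proof.
move=> Js Jt; apply: (@observed_eq _ _ [set f | exists q : rat,
    ([set f | [set` `]-oo, ratr q[] (f s)] `&`
     [set f | [set` `]ratr q, +oo[] (f t)]) f]).
  move=> f cf; split => [/= /rat_in_itvoo[q]|[q /= []]].
    by rewrite in_itv /= => /andP[? ?]; exists q; rewrite /= !in_itv /= andbT.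
  by rewrite !in_itv /= andbT; exact: lt_trans.
apply: observed_exists => q; apply: observedI; apply: observed_coord => //;
  exact: measurable_itv.
Qed.

(** [first_time X D w] unfolds to [hit D (X ^~ w)]: hitting is a matter of the
    path alone, which lets shifted paths be treated as well. *)
Definition hit D f : \bar R :=
  ereal_inf [set t%:E | t in [set t | 0 < t /\ D t (f t)]].

Definition closed_at D t x := ~ D t x -> \forall p \near (t, x), ~ D p.1 p.2.

Lemma hit_ge0 D f : (0 <= hit D f)%E.
Proof. by apply/ereal_infP => _ [t [/ltW t0 _] <-]; rewrite lee_fin. Qed.

Lemma hit_lt D f s : (hit D f < s%:E)%E <-> exists2 t, 0 < t < s & D t (f t).
Proof.
split=> [/ereal_inf_lt[_ [t [t0 Dt] <-]]|[t /andP[t0 ts] Dt]].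
  by rewrite lte_fin => ts; exists t => //; rewrite t0.
apply: (@le_lt_trans _ _ t%:E); last by rewrite lte_fin.
by apply: ereal_inf_lbound; exists t.
Qed.

Lemma hit_le D f t : 0 < t -> D t (f t) -> (hit D f <= t%:E)%E.
Proof. by move=> t0 Dt; apply: ereal_inf_lbound; exists t. Qed.

Lemma hit_lty D f : (hit D f < +oo)%E <-> exists2 t, 0 < t & D t (f t).
Proof.
split=> [/ereal_inf_lt[_ [t [t0 Dt] <-] _]|[t t0 Dt]]; first by exists t.
by apply: le_lt_trans (hit_le t0 Dt) _; exact: ltry.
Qed.

Lemma hit_fine D f : (hit D f < +oo)%E -> hit D f = (fine (hit D f))%:E.
Proof. by move=> ?; rewrite fineK// ge0_fin_numE// hit_ge0. Qed.

Lemma fine_hit_ge0 D f : 0 <= fine (hit D f).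
Proof. by rewrite fine_ge0// hit_ge0. Qed.

(** Otherwise a whole product neighbourhood of the point reached would avoid
    the region, and by continuity the path would stay in it for a while. *)
Lemma hit_attained D f (t := fine (hit D f)) : cpath f ->
  (hit D f < +oo)%E -> closed_at D t (f t) -> D t (f t).
Proof.
move=> cf hf cl; apply: contrapT => /cl [[/= V W] [Vt Wf] VW].
have t0 : 0 <= t by exact: fine_hit_ge0.
have /nbhs_ballP[e /= e0 H] : \forall s \near t, V s /\ (0 <= s -> W (f s)).
  by apply: filterI => //; exact: cf.
have : (hit D f < (t + e)%:E)%E by rewrite hit_fine// lte_fin ltrDl.
move=> /hit_lt[s /andP[s0 st] Ds].
have ts : t <= s.
  by rewrite -lee_fin -hit_fine//; exact: hit_le.
have [|Vs /(_ (ltW s0)) Ws] := H s.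
  by rewrite /ball /= ltr_distlC; apply/andP; split; lra.
by apply: (VW (s, f s)).
Qed.

End continuous_paths.

(** * Events decided by a continuous path *)

Section observability.
Context {R : realType}.
Implicit Types (f : R -> R) (D : R -> R -> Prop) (J : set R) (E : set (R -> R)).

Lemma small_nat (e : R) : 0 < e -> exists n, n.+1%:R^-1 < e.
Proof.
move=> e0; have [n _ /(_ n (leqnn n))] := near_infty_natSinv_lt (PosNum e0).
by exists n.
Qed.

Definition closed_region D := forall t x, 0 < t -> closed_at D t x.

Definition hitin D (a c : R) f := exists2 s, a <= s <= c & D s (f s).

(** By compactness the graph of the path over [a, c] meets the closed region
    if and only if it comes within 1/(m+1) of it at some rational time, for
    every m. *)
Lemma observed_hitin J D a c : closed_region D -> 0 < a -> a < c ->
  (forall s, a <= s <= c -> J s) -> observed J (hitin D a c).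
Proof.
move=> clD a0 ac JJ.
pose nearD m (q y : R) := exists p : R * R,
  [/\ a <= p.1 <= c, D p.1 p.2, `|p.1 - q| < m.+1%:R^-1 & ball p.2 m.+1%:R^-1 y].
apply: (@observed_eq _ _ _ [set f | forall m : nat, exists q : rat,
   a < ratr q < c /\ nearD m (ratr q) (f (ratr q))]); last first.
  apply: observed_forall => m; apply: observed_exists => q.
  apply: observed_and => /andP[/ltW aq /ltW qc].
  apply: (@observed_coord _ J (ratr q) [set y | nearD m (ratr q) y]).
    by apply: JJ; rewrite aq.
  apply: open_measurable.
  rewrite (_ : [set _ | _] = \bigcup_(p in [set p : R * R |
    [/\ a <= p.1 <= c, D p.1 p.2 & `|p.1 - ratr q| < m.+1%:R^-1]])
      ball p.2 m.+1%:R^-1).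
    by apply: bigcup_open => p _; apply: ball_open; rewrite invr_gt0 ltr0n.
  by apply/seteqP; split => y [p [? ? ?]]; [move=> ?|]; exists p.
move=> f cf; split => [[s /andP[as_ sc] Ds] m|H].
  have s0 : 0 <= s by rewrite (le_trans _ as_)// ltW.
  have m0 : 0 < m.+1%:R^-1 :> R by rewrite invr_gt0 ltr0n.
  have /nbhs_ballP[e /= e0 He] := cf s s0 _ (nbhsx_ballx (f s) _ m0).
  have : exists2 q : rat, a < ratr q < c & `|s - ratr q| < Num.min e m.+1%:R^-1.
    set e' := Num.min e m.+1%:R^-1.
    have e'0 : 0 < e' by rewrite lt_min e0.
    have : Num.max a (s - e') < Num.min c (s + e').
      by by rewrite gt_max !lt_min ac; lra.
    move=> /rat_in_itvoo[q]; rewrite in_itv /= gt_max lt_min.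
    move=> /andP[/andP[aq q1] /andP[qc q2]]; exists q; first by rewrite aq.
    by rewrite ltr_distlC; apply/andP; split; lra.
  move=> [q /andP[aq qc]]; rewrite lt_min => /andP[qe qm].
  exists q; split; first by rewrite aq.
  exists (s, f s); split => //=; first by rewrite as_.
  by apply: He => //; rewrite (le_trans _ (ltW aq))// ltW.
apply: contrapT => nh.
have cov : forall s, [set` `[a, c]] s ->
    \forall q \near s & m \near \oo, ~ nearD m q (f q).
  move=> s /=; rewrite in_itv /= => /andP[as_ sc].
  have s0 : 0 < s by exact: lt_le_trans as_.
  have /(clD _ _ s0) : ~ D s (f s) by move=> Ds; apply: nh; exists s; rewrite ?as_.
  move=> [[/= V W] [Vs Ws] VW].
  have /nbhs_ballP[e1 /= e10 He1] := Vs.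
  have /nbhs_ballP[e2 /= e20 He2] := Ws.
  pose e := Num.min e1 e2 / 2.
  have e0 : 0 < e by rewrite divr_gt0// lt_min e10.
  have e1e : e * 2 <= e1 by rewrite /e -mulrA mulVf// mulr1 ge_min lexx.
  have e2e : e * 2 <= e2 by rewrite /e -mulrA mulVf// mulr1 ge_min lexx orbT.
  clearbody e.
  exists ([set q | 0 <= q /\ ball s e q /\ ball (f s) e (f q)],
          [set m | m.+1%:R^-1 < e]).
    split => /=; last exact: (near_infty_natSinv_lt (PosNum e0)).
    have N0 : \forall q \near s, 0 <= q.
      by near=> q; apply: ltW; near: q; exact: lt_nbhsr.
    have N1 := nbhsx_ballx s _ e0.
    have N2 := cf s (ltW s0) _ (nbhsx_ballx (f s) _ e0).
    near=> q; do !split.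
    - by near: q.
    - by near: q.
    - have q0 : 0 <= q by near: q.
      by apply: (near N2 q).
  move=> [q m] [/= [q0 [sq fq]] me] [[u v] [/= uac Duv uq vq]].
  move: (m.+1%:R^-1) me uq vq => r me uq vq.
  apply: (VW (u, v)) => //; split => /=.
    apply: He1; move: sq uq; rewrite /ball /= => sq uq.
    rewrite (le_lt_trans (ler_distD q _ _))// (distrC q).
    lra.
  apply: He2; move: fq vq; rewrite /ball /= => fq vq.
  rewrite (le_lt_trans (ler_distD (f q) _ _))// (distrC (f q)).
  lra.
have [M _ HM] := (compact_near_coveringP _).1 (@segment_compact _ a c) nat \oo
  (fun m q => ~ nearD m q (f q)) _ cov.
have [q [/andP[aq qc] nq]] := H M.
by apply: (HM M (leqnn M) (ratr q)) => //=; rewrite in_itv /= !ltW.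
Unshelve. all: by end_near. Qed.

Lemma observed_hit_le D t : closed_region D ->
  observed [set s | 0 <= s <= t] [set f | exists2 s, 0 < s <= t & D s (f s)].
Proof.
move=> clD; have [t0|t0] := leP t 0.
  apply: observed_eq (observed0 _) => f cf; split => // -[s /andP[s0 st]].
  by have := lt_le_trans s0 (le_trans st t0); rewrite ltxx.
apply: (@observed_eq _ _ _ [set f | exists k : nat,
   hitin D (t * k.+2%:R^-1) t f]).
  move=> f cf; split => [[s /andP[s0 st] Ds]|[k [s /andP[ks st] Ds]]].
    have [k kst] := small_nat (divr_gt0 s0 t0).
    exists k, s => //; rewrite st andbT.
    rewrite -ler_pdivlMl// mulrC (le_trans _ (ltW kst))//.
    by rewrite lef_pV2 ?posrE ?ltr0n// ler_nat.
  by exists s => //; rewrite st (lt_le_trans _ ks)// mulr_gt0// invr_gt0 ltr0n.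
apply: observed_exists => k; apply: observed_hitin => //.
- by rewrite mulr_gt0// invr_gt0 ltr0n.
- by rewrite gtr_pMr// invf_lt1// ltr1n.
- move=> s /andP[ks st]; rewrite /= st andbT (le_trans _ ks)//.
  by rewrite mulr_ge0 ?invr_ge0// ltW.
Qed.

Lemma observed_hit_lt D t : closed_region D ->
  observed [set s | 0 <= s <= t] [set f | (hit D f < t%:E)%E].
Proof.
move=> clD; apply: (@observed_eq _ _ _ [set f | exists q : rat, ratr q < t /\
   (exists2 s, 0 < s <= ratr q & D s (f s))]).
  move=> f cf; split => [/hit_lt[s /andP[s0 st] Ds]|[q [qt [s /andP[s0 sq] Ds]]]].
    have /rat_in_itvoo[q] := st; rewrite in_itv /= => /andP[sq qt].
    by exists q; split => //; exists s; rewrite ?s0// ltW.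
  by apply/hit_lt; exists s; rewrite // s0 (le_lt_trans sq).
apply: observed_exists => q; apply: observed_and => qt.
apply: observed_sub (observed_hit_le _ _) => // s /andP[s0 sq].
by rewrite /= s0 (le_trans sq)// ltW.
Qed.

Lemma observed_finite D : closed_region D ->
  observed [set s | 0 <= s] [set f | (hit D f < +oo)%E].
Proof.
move=> clD; apply: (@observed_eq _ _ _ [set f | exists n : nat, (hit D f < n%:R%:E)%E]).
  move=> f cf; split => [hf|[n hn]]; last by apply: lt_trans hn _; exact: ltry.
  exists (Num.bound (fine (hit D f))).
  by rewrite hit_fine// lte_fin archi_boundP// fine_hit_ge0.
apply: observed_exists => n.
by apply: observed_sub (observed_hit_lt _ _) => // s /andP[].
Qed.

(** A sign that lets statements about upward and downward moves be made and
    proved together. *)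
Definition side (b : bool) (x : R) := if b then x else - x.

Lemma sideK b : involutive (side b).
Proof. by case: b => x //=; rewrite opprK. Qed.

Lemma side_gt_nbhs b (a x : R) : a < side b x -> nbhs x [set y | a < side b y].
Proof.
case: b => /= ax; first exact: lt_nbhsr.
by near=> y; rewrite /= ltrNr; near: y; apply: lt_nbhsl; rewrite ltrNr.
Unshelve. all: by end_near. Qed.

Lemma side_lt_nbhs b (a x : R) : side b x < a -> nbhs x [set y | side b y < a].
Proof.
case: b => /= ax; first exact: lt_nbhsl.
by near=> y; rewrite /= ltrNl; near: y; apply: lt_nbhsr; rewrite ltrNl.
Unshelve. all: by end_near. Qed.

Definition crosses b f := forall e, 0 < e ->
  exists2 t, 0 < t < e & side b (f 0) < side b (f t).

Lemma observed_crosses b : observed [set s | 0 <= s] (crosses b).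
Proof.
apply: (@observed_eq _ _ _ [set f | forall k : nat, exists q : rat,
   0 < (ratr q : R) < k.+1%:R^-1 /\ side b (f 0) < side b (f (ratr q))]).
  move=> f cf; split => [cr k|H e e0].
    have [|t /andP[t0 tk] ft] := cr k.+1%:R^-1; first by rewrite invr_gt0 ltr0n.
    have := side_gt_nbhs ft.
    move=> /(cf t (ltW t0))/nbhs_ballP[e /= e0 He].
    have /rat_in_itvoo[q] : t < Num.min (t + e) k.+1%:R^-1 by rewrite lt_min tk ltrDl e0.
    rewrite in_itv /= lt_min => /andP[tq /andP[qe qr]].
    have q0 : 0 < ratr q :> R by rewrite (lt_trans t0).
    exists q; rewrite q0; split => //; apply: He; last exact: ltW.
    by rewrite /ball /= ltr_distlC; apply/andP; split; lra.
  have [k ke] := small_nat e0; have [q [/andP[q0 qk] fq]] := H k.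
  by exists (ratr q) => //; rewrite q0 (lt_trans qk).
apply: observed_forall => k; apply: observed_exists => q.
apply: observed_and => /andP[/ltW q0 _].
case: b => /=; first by apply: observed_lt => /=.
apply: (@observed_eq _ _ _ [set f | f (ratr q) < f 0]); last by apply: observed_lt => /=.
by move=> f cf; rewrite /= ltrN2.
Unshelve. all: by end_near. Qed.

End observability.

(** * Almost sure statements and finite unions *)

Section almost_sure.
Context {R : realType} {d : measure_display} {T : measurableType d}
  (P : probability T R).
Implicit Types A B : set T.
Local Open Scope ereal_scope.

Lemma as_of_prob1 A : measurable A -> P A = 1 -> {ae P, forall w, A w}.
Proof.
move=> mA PA; exists (~` A); split => //; first exact: measurableC.
by rewrite probability_setC// PA subee.
Qed.

Lemma as_of_eq_prob A B : measurable A -> measurable B -> B `<=` A ->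
  P B = P A -> {ae P, forall w, A w -> B w}.
Proof.
move=> mA mB BA PBA; exists (A `\` B); split; first exact: measurableD.
  have PD : P (A `\` B) = P A - P B.
    rewrite measureD//; last by rewrite (le_lt_trans (probability_le1 _ _))// ltry.
    by rewrite (setIidr BA).
  by rewrite PD PBA subee// fin_num_measure.
by move=> w /not_implyP.
Qed.

Lemma le_prob_as A B : measurable A -> measurable B ->
  {ae P, forall w, A w -> B w} -> P A <= P B.
Proof.
move=> mA mB [N [mN PN sN]]; have mBN : measurable (B `|` N) by exact: measurableU.
apply: (@le_trans _ _ (P (B `|` N))).
  apply: le_measure; rewrite ?inE// => w Aw.
  by have [?|nB] := pselect (B w); [left|right; apply: sN => /(_ Aw)].
have {}PN : P N <= 0 by rewrite PN.
by apply: (le_trans (measureU2 _ mB mN)); rewrite geeDl.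
Qed.

Lemma eq_prob_as A B : measurable A -> measurable B ->
  {ae P, forall w, A w <-> B w} -> P A = P B.
Proof.
move=> mA mB AB; apply/eqP; rewrite eq_le.
by apply/andP; split; apply: le_prob_as => //; apply: filterS AB => w [].
Qed.

Lemma prob1_of_as A : measurable A -> {ae P, forall w, A w} -> P A = 1.
Proof.
by move=> mA aA; rewrite -(probability_setT P); apply: eq_prob_as => //;
  apply: filterS aA.
Qed.

(** Fatou lemma for events. *)
Lemma le_prob_eventually A (B : (set T)^nat) c : measurable A ->
  (forall n, measurable (B n)) ->
  {ae P, forall w, A w -> \forall n \near \oo, B n w} ->
  (\forall n \near \oo, P (B n) <= c) -> P A <= c.
Proof.
move=> mA mB AB [N0 _ PB].
pose C N := \bigcap_(n in [set n | (N <= n)%N]) B n.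
have mC N : measurable (C N) by apply: bigcap_measurableType => k _; exact: mB.
have mUC : measurable (\bigcup_N C N) by exact: bigcup_measurable.
apply: (@le_trans _ _ (P (\bigcup_N C N))).
  apply: le_prob_as => //.
have nC : nondecreasing_seq C.
  move=> m n mn; apply/subsetPset => w Cw k /= nk.
  by apply: Cw; rewrite /= (leq_trans mn).
have cv := nondecreasing_cvg_mu (mu := P) mC mUC nC.
rewrite -(cvg_lim _ cv)//; apply: lime_le; first by apply/cvg_ex; eexists; exact: cv.
exists N0 => // n N0n; apply: le_trans (PB n N0n).
by apply: le_measure; rewrite ?inE// => w; apply => /=.
Qed.

End almost_sure.

Section vanishing.
Context {R : realType} {d : measure_display} {T : measurableType d}
  (P : probability T R).
Local Open Scope ereal_scope.

(** Along events that eventually fail at each point, the probability gets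
    small: otherwise Fatou applied to the complements would bound the mass of
    the whole space away from 1. *)
Lemma prob_vanish (A : (set T)^nat) (r : R) : (forall n, measurable (A n)) ->
  (forall w, \forall n \near \oo, ~ A n w) -> (0 < r)%R ->
  exists n, P (A n) <= r%:E.
Proof.
move=> mA A0 r0; apply/not_existsP => H.
have : P setT <= (1 - r)%:E.
  apply: (le_prob_eventually (B := fun n => ~` A n)) => //.
  - by move=> n; exact: measurableC.
  - by apply: aeW => w _; exact: A0.
  - apply: nearW => n; rewrite probability_setC// EFinB leeB//.
    by apply/ltW; rewrite ltNge; apply/negP/H.
by rewrite probability_setT lee_fin; lra.
Qed.

End vanishing.

Section finite_unions.
Context {R : realType} {d : measure_display} {T : measurableType d}
  (P : probability T R) {I : finType} (Q : pred I) (F : I -> set T).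
Hypothesis mF : forall i, measurable (F i).
Local Open Scope ereal_scope.

Lemma measurable_finite_union : measurable [set w | exists2 i, Q i & F i w].
Proof.
have -> : [set w | exists2 i, Q i & F i w] = \big[setU/set0]_(i | Q i) F i.
  by rewrite -bigcup_pred.
by apply: bigsetU_measurable => i _.
Qed.

Lemma prob_finite_union_le :
  P [set w | exists2 i, Q i & F i w] <= \sum_(i | Q i) P (F i).
Proof.
have -> : [set w | exists2 i, Q i & F i w] = \big[setU/set0]_(i | Q i) F i.
  rewrite -bigcup_pred; apply/seteqP; split => w; first by move=> [i Qi Fi]; exists i.
  by move=> [i Qi Fi]; exists i.
suff : measurable (\big[setU/set0]_(i | Q i) F i) /\
  P (\big[setU/set0]_(i | Q i) F i) <= \sum_(i | Q i) P (F i) by case.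
elim/big_rec2 : _ => [|i x A Qi [mA PA]]; first by rewrite measure0.
split; first exact: measurableU.
by apply: (le_trans (measureU2 _ (mF i) mA)); exact: leeD2l.
Qed.

Lemma prob_disjoint_union : (forall i j w, F i w -> F j w -> i = j) ->
  P [set w | exists2 i, Q i & F i w] = \sum_(i | Q i) P (F i).
Proof.
move=> dF; pose G i := if Q i then F i else set0.
have -> : [set w | exists2 i, Q i & F i w] = \bigcup_(i in [set` index_enum I]) G i.
  apply/seteqP; split => w [i Qi Fi]; last first.
    by exists i; move: Fi; rewrite /G; case: ifP.
  by exists i; rewrite /= ?mem_index_enum// /G Qi.
rewrite measure_fin_bigcup//.
- rewrite -fsbig_seq ?index_enum_uniq// [RHS]big_mkcond/=.
  by apply: eq_bigr => i _; rewrite /G; case: ifP => // _; rewrite measure0.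
- apply/trivIsetP => i j _ _ /eqP ij; apply/seteqP; split => w // [Gi Gj].
  by apply: ij; move: Gi Gj; rewrite /G; case: ifP => // _; case: ifP => // _; exact: dF.
- by move=> i _; rewrite /G; case: ifP.
Qed.

End finite_unions.

(** * Measurability and the strong Markov property of diffusions *)

Section diffusion_basics.
Context {R : realType} {d : measure_display} {T : measurableType d}
  {P : R -> probability T R} {X : R -> T -> R} (hX : diffusion P X).
Implicit Types (D : R -> R -> Prop) (E : set (R -> R)) (G : set T)
  (tau : T -> \bar R).

Lemma path_cpath w : cpath (X ^~ w).
Proof. by apply: within_cpath; exact: (diffusion_continuous hX). Qed.

Arguments path_cpath w : clear implicits.

Lemma shift_cpath tau : (forall w, (0 <= tau w)%E) -> forall w,
  cpath (fun s => X (fine (tau w) + s) w).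
Proof. by move=> t0 w; apply: cpath_shift (path_cpath w); exact: fine_ge0. Qed.
Arguments shift_cpath [tau] _ w.

Lemma sigma_algebra_preimage_paths (F : set (set T)) : sigma_algebra setT F ->
  sigma_algebra setT [set B : set (R -> R) | F [set w | B (X ^~ w)]].
Proof.
move=> [F0 FC FU]; split => [|A /= FA|A FA] /=.
- by rewrite (_ : [set w | set0 (X ^~ w)] = set0)//.
- rewrite (_ : [set _ | _] = setT `\` [set w | A (X ^~ w)]); first exact: FC.
  by apply/seteqP; split.
- rewrite (_ : [set _ | _] = \bigcup_n [set w | A n (X ^~ w)]); first exact: FU.
  by apply/seteqP; split.
Qed.

Lemma observed_preimage J (F : set (set T)) E : sigma_algebra setT F ->
  (forall s (A : set (measurableTypeR R)), J s -> measurable A -> F (X s @^-1` A)) ->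
  observed J E -> F [set w | E (X ^~ w)].
Proof.
move=> sF genF [B mB EB].
rewrite (_ : [set _ | _] = [set w | B (X ^~ w)]); last first.
  by apply/seteqP; split => w /(EB _ (path_cpath w)).
apply: (smallest_sub (sigma_algebra_preimage_paths sF) _ mB).
by move=> _ [s [A [Js mA ->]]]; exact: genF.
Qed.

Lemma observed_natural t E : observed [set s | 0 <= s <= t] E ->
  natural_filtration X t [set w | E (X ^~ w)].
Proof.
apply: observed_preimage; first exact: smallest_sigma_algebra.
by move=> s A st mA; apply: sub_sigma_algebra; exists s, A.
Qed.

Lemma observed_measurable E : observed [set s | 0 <= s] E ->
  measurable [set w | E (X ^~ w)].
Proof.
apply: observed_preimage; first exact: sigma_algebra_measurable.
move=> s A s0 mA; rewrite -[_ @^-1` _]setTI.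
by apply: (diffusion_measurable hX).
Qed.

Lemma natural_measurable t : natural_filtration X t `<=` measurable.
Proof.
apply: smallest_sub; first exact: sigma_algebra_measurable.
move=> _ [s [A [/andP[s0 _] mA ->]]]; rewrite -[_ @^-1` _]setTI.
by apply: (diffusion_measurable hX).
Qed.

Lemma naturalI t G G' : natural_filtration X t G ->
  natural_filtration X t G' -> natural_filtration X t (G `&` G').
Proof.
move=> nG nG'; rewrite -[G]setCK -[G']setCK -setCU.
apply: sigma_algebraC; rewrite -bigcup2E; apply: sigma_algebra_bigcup => -[|[|i]] /=;
  [exact: sigma_algebraC|exact: sigma_algebraC|exact: sigma_algebra0].
Qed.

Lemma natural_bigcup t (F : (set T)^nat) :
  (forall n, natural_filtration X t (F n)) ->
  natural_filtration X t (\bigcup_n F n).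
Proof. exact: sigma_algebra_bigcup. Qed.

Lemma natural_le s t : s <= t ->
  natural_filtration X s `<=` natural_filtration X t.
Proof.
move=> st; apply: sub_sigma_algebra2 => _ [r [A [/andP[r0 rs] mA ->]]].
by exists r, A; rewrite r0 (le_trans rs).
Qed.

Lemma markov_hit D : closed_region D -> markov_time X (first_time X D).
Proof.
move=> clD; split => [w|t t0]; first exact: hit_ge0.
exact: observed_natural (observed_hit_lt t clD).
Qed.

Lemma markov_constant (s : R) : 0 <= s -> markov_time X (fun=> s%:E).
Proof.
move=> s0; split => [w|t t0]; first by rewrite lee_fin.
have [st|st] := ltP s t.
  rewrite (_ : [set _ | _] = ~` set0).
    by apply: sigma_algebraC; exact: sigma_algebra0.
  by apply/seteqP; split => w /=; rewrite ?lte_fin ?st// => _ [].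
rewrite (_ : [set _ | _] = set0); first exact: sigma_algebra0.
by apply/seteqP; split => w //=; rewrite lte_fin; move: st; rewrite leNgt => /negP.
Qed.

Lemma prior_setT tau : markov_time X tau -> prior_event X tau setT.
Proof. by move=> [_ mt] t t0; rewrite setTI; exact: mt. Qed.

Lemma prior_start tau x : markov_time X tau -> prior_event X tau [set w | X 0 w = x].
Proof.
move=> [_ mt] t t0; apply: naturalI; last exact: mt.
apply: sub_sigma_algebra; exists 0, [set x]; split => //=.
by rewrite lexx.
Qed.

(** A rational number separates the two times, and what happens before it is
    known before [t]. *)
Lemma prior_lt tau tau' : markov_time X tau -> markov_time X tau' ->
  prior_event X tau [set w | (tau w < tau' w)%E].
Proof.
move=> [t0 mt] [t'0 mt'] t tge0.
pose F (q : rat) : set T := if 0 <= (ratr q : R) < t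
  then [set w | (tau w < (ratr q)%:E)%E] `&` ~` [set w | (tau' w < (ratr q)%:E)%E]
  else set0.
have nF q : natural_filtration X t (F q).
  rewrite /F; case: ifPn => [/andP[q0 qt]|_]; last exact: sigma_algebra0.
  apply: (natural_le (ltW qt)); apply: naturalI; first exact: mt.
  by apply: sigma_algebraC; exact: mt'.
suff -> : [set w | (tau w < tau' w)%E] `&` [set w | (tau w < t%:E)%E] =
    \bigcup_n (oapp F set0 (unpickle n)).
  apply: natural_bigcup => n; case: (unpickle n) => [q|]; first exact: nF.
  exact: sigma_algebra0.
apply/seteqP; split => [w [/= tt' tt]|w [n _]]; last first.
  case: (unpickle n) => [q|//]; rewrite /F /=.
  case: ifPn => [/andP[q0 qt]|//] [/= tq /negP].
  rewrite -leNgt => qt'; split; first exact: lt_le_trans qt'.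
  by apply: (lt_trans tq); rewrite lte_fin.
have tf : tau w \is a fin_num by rewrite ge0_fin_numE// (lt_trans tt)// ltry.
have [q [tq qt' qt]] : exists q : rat, [/\ (tau w < (ratr q)%:E)%E,
    ((ratr q)%:E <= tau' w)%E & ratr q < t].
  case: (tau' w) (t'0 w) tt' => [r| |]//=.
  - move=> _; rewrite -(fineK tf) lte_fin => tr.
    have : fine (tau w) < Num.min r t by rewrite lt_min tr -lte_fin fineK.
    move=> /rat_in_itvoo[q]; rewrite in_itv /= lt_min => /andP[tq /andP[qr qt]].
    by exists q; rewrite lte_fin tq lee_fin (ltW qr).
  - move=> _ _; rewrite -(fineK tf).
    have : fine (tau w) < t by rewrite -lte_fin fineK.
    move=> /rat_in_itvoo[q]; rewrite in_itv /= => /andP[tq qt].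
    by exists q; rewrite lte_fin tq leey.
have q0 : 0 <= (ratr q : R) by rewrite -lee_fin (le_trans (t0 w))// ltW.
exists (pickle q); first by [].
rewrite pickleK /= /F q0 qt.
by split => //=; apply/negP; rewrite -leNgt.
Qed.

Lemma measurable_prior tau G : markov_time X tau -> prior_event X tau G ->
  measurable (G `&` finite_time tau).
Proof.
move=> [t0 mt] pG.
rewrite (_ : _ `&` _ = \bigcup_n (G `&` [set w | (tau w < n%:R%:E)%E])).
  by apply: bigcup_measurable => n _; apply: (@natural_measurable n%:R); apply: pG.
apply/seteqP; split => [w [Gw tw]|w [n _ [Gw tw]]]; last first.
  by split => //; apply: lt_trans tw _; exact: ltry.
have tf : tau w \is a fin_num by rewrite ge0_fin_numE.
exists (Num.bound (fine (tau w))) => //; split => //=.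
by rewrite -(fineK tf) lte_fin archi_boundP// fine_ge0.
Qed.

(** By continuity [X] exceeds [a] at time [tau] if and only if it exceeds some
    rational larger than [a] at all rational times of a rational interval
    containing [tau]. *)
Lemma measurable_stopped tau (A : set (measurableTypeR R)) :
  (forall w, (0 <= tau w)%E) ->
  (forall t : R, measurable [set w | (tau w < t%:E)%E]) ->
  measurable A -> measurable (finite_time tau `&` stopped X tau @^-1` A).
Proof.
move=> t0 mt; have mfin : measurable (finite_time tau).
  rewrite (_ : finite_time tau = \bigcup_n [set w | (tau w < n%:R%:E)%E]).
    exact: bigcup_measurable.
  apply/seteqP; split => [w tw|w [n _]]; last by move/lt_trans; apply; exact: ltry.
  exists (Num.bound (fine (tau w))) => //=.
  have tf : tau w \is a fin_num by rewrite ge0_fin_numE.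
  by rewrite -(fineK tf) lte_fin archi_boundP// fine_ge0.
move: A; suff : measurable_fun (finite_time tau)
    (stopped X tau : T -> measurableTypeR R).
  by move=> mX A mA; exact: mX.
apply: (measurability _ (RGenOInfty.measurableE R)) => _ [_ [a ->] <-].
pose F (r : rat * rat * rat) : set T := ([set w | (tau w < (ratr r.2 : R)%:E)%E]
   `\` [set w | (tau w < (ratr r.1.2 : R)%:E)%E]) `&`
   [set w | a < ratr r.1.1 /\ forall q : rat,
      [&& (ratr r.1.2 : R) < ratr q, (ratr q : R) < ratr r.2 & 0 <= (ratr q : R)] ->
        ratr r.1.1 < X (ratr q) w].
suff -> : finite_time tau `&` stopped X tau @^-1` `]a, +oo[ = \bigcup_r F r.
  apply: countable_bigcupT_measurable; first exact: countableP.
  move=> r; rewrite /F; apply: measurableI; first exact: measurableD.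
  apply: (@observed_measurable [set f | a < ratr r.1.1 /\ forall q : rat,
      [&& (ratr r.1.2 : R) < ratr q, (ratr q : R) < ratr r.2 & 0 <= (ratr q : R)] ->
        ratr r.1.1 < f (ratr q)]).
  apply: observed_and => _; apply: observed_forall => q.
  have [/and3P[_ _ q0]|] := boolP [&& _, _ & _]; last first.
    move=> _; apply: (@observed_eq _ _ _ (~` set0)); last exact/observedC/observed0.
    by move=> f cf; split => [_ []|].
  apply: observed_imply.
  apply: (@observed_eq _ _ _ [set f | [set` `]ratr r.1.1, +oo[] (f (ratr q))]).
    by move=> f cf; rewrite /= in_itv /= andbT.
  by apply: observed_coord => //; exact: measurable_itv.
apply/seteqP; split => [w [tw]|w [[[a' p] r] _ [[/= tr pt] [aa' H]]]].
  rewrite /stopped /= in_itv /= andbT => aX.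
  have tf : tau w \is a fin_num by rewrite ge0_fin_numE.
  set t := fine (tau w) in aX.
  have tge0 : 0 <= t by rewrite fine_ge0.
  have /rat_in_itvoo[a'] := aX; rewrite in_itv /= => /andP[aa' a't].
  have /nbhs_ballP[e /= e0 He] := path_cpath w t tge0 _ (lt_nbhsr a't).
  have /rat_in_itvoo[p] : t - e < t by rewrite ltrBlDr ltrDl.
  have /rat_in_itvoo[r] : t < t + e by rewrite ltrDl.
  rewrite !in_itv /= => /andP[tr re] /andP[pe pt].
  exists ((a', p), r) => //=; split; split => //=.
  - by rewrite -(fineK tf) lte_fin.
  - by rewrite -(fineK tf) lte_fin -/t => /(lt_trans pt); rewrite ltxx.
  - move=> q /and3P[pq qr q0]; apply: He => //.
    by rewrite /ball /= ltr_distlC; apply/andP; split; lra.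
have tf : tau w \is a fin_num by rewrite ge0_fin_numE// (lt_trans tr)// ltry.
split; first by rewrite /finite_time /= -ge0_fin_numE.
rewrite /stopped /= in_itv /= andbT.
set t := fine (tau w); have tge0 : 0 <= t by rewrite fine_ge0.
rewrite (lt_le_trans aa')// leNgt; apply/negP => fta'.
have /nbhs_ballP[e /= e0 He] := path_cpath w t tge0 _ (lt_nbhsl fta').
move: tr pt; rewrite -(fineK tf) -/t lte_fin => tr /negP; rewrite -leNgt lee_fin => pt.
have /rat_in_itvoo[q] : t < Num.min (t + e) (ratr r) by rewrite lt_min tr ltrDl e0.
rewrite in_itv /= lt_min => /andP[tq /andP[qe qr]].
have q0 : 0 <= ratr q :> R by rewrite (le_trans tge0)// ltW.
have : X (ratr q) w < ratr a'.
  by apply: He => //; rewrite /ball /= ltr_distlC; apply/andP; split; lra.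
by apply/negP; rewrite -leNgt; apply/ltW/H; rewrite q0 qr !andbT; exact: le_lt_trans tq.
Qed.

Lemma measurable_shift tau E : (forall w, (0 <= tau w)%E) ->
  (forall t : R, measurable [set w | (tau w < t%:E)%E]) ->
  observed [set s | 0 <= s] E -> measurable (finite_time tau `&`
     [set w | E (fun s => X (fine (tau w) + s) w)]).
Proof.
move=> t0 mt [B mB EB].
have -> : [set w | E (fun s => X (fine (tau w) + s) w)] =
          [set w | B (fun s => X (fine (tau w) + s) w)].
  by apply/seteqP; split => w /(EB _ (shift_cpath t0 w)).
have stop A := measurable_stopped (A := A) t0 mt.
have mfin : measurable (finite_time tau).
  by rewrite -(setIT (finite_time _)); exact: stop setT _.
pose F (B : set (R -> R)) := measurable (finite_time tau `&`
     [set w | B (fun s => X (fine (tau w) + s) w)]).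
apply: (smallest_sub (_ : sigma_algebra setT F) _ mB).
  split => [|A /= FA|A FA]; rewrite /F.
  - by rewrite [X in measurable X](_ : _ = set0)//; apply/seteqP; split => w [].
  - rewrite (_ : _ `&` _ = finite_time tau `\` (finite_time tau `&`
     [set w | A (fun s => X (fine (tau w) + s) w)])); first exact: measurableD.
    apply/seteqP; split => w [tw]; first by move=> [_ nA]; split => // -[].
    by move=> nA; split => //; split => // Aw; apply: nA.
  - rewrite (_ : _ `&` _ = \bigcup_n (finite_time tau `&`
     [set w | A n (fun s => X (fine (tau w) + s) w)])).
      by apply: bigcup_measurable => n _; exact: FA.
    apply/seteqP; split => w; first by move=> [tw [n _ An]]; exists n.
    by move=> [n _ [tw An]]; split => //; exists n.
move=> _ [s [A [s0 mA ->]]]; rewrite /F.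
pose tau' w := (tau w + s%:E)%E.
rewrite (_ : _ `&` _ = finite_time tau' `&` stopped X tau' @^-1` A).
  apply: measurable_stopped => // [w|t]; first by rewrite adde_ge0// lee_fin.
  rewrite (_ : [set _ | _] = [set w | (tau w < (t - s)%:E)%E])//.
  by apply/seteqP; split => w; rewrite /= /tau' EFinB lteBrDr.
apply/seteqP; split => w [tw]; rewrite /stopped /finite_time /tau' /= in tw *.
  have tf : tau w \is a fin_num by rewrite ge0_fin_numE.
  by rewrite fineD//= -(fineK tf); split => //; rewrite -EFinD ltry.
have tf : tau w \is a fin_num.
  by rewrite ge0_fin_numE// (le_lt_trans _ tw)// leeDl// lee_fin.
by rewrite fineD//=; split => //; rewrite -ge0_fin_numE.
Qed.

(** When the restarted process has the same chance [c] of realising [E] from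
    all the points where it may restart, the integral over these points is a
    product. *)
Lemma restart x tau G E (c : \bar R) : markov_time X tau ->
  prior_event X tau G -> observed [set s | 0 <= s] E ->
  (forall w, G w -> finite_time tau w ->
     P (stopped X tau w) [set w' | E (X ^~ w')] = c) ->
  P x (G `&` finite_time tau `&` [set w | E (fun s => X (fine (tau w) + s) w)]) =
  (c * P x (G `&` finite_time tau))%E.
Proof.
move=> mt pG [B mB EB] Ec.
have -> : [set w | E (fun s => X (fine (tau w) + s) w)] =
          [set w | B (fun s => X (fine (tau w) + s) w)].
  by apply/seteqP; split => w /(EB _ (shift_cpath mt.1 w)).
rewrite (diffusion_strong_markov hX)// -integral_cst//; last exact: measurable_prior.
apply: eq_integral => w; rewrite inE => -[Gw tw] /=.
rewrite -(Ec w)//; congr (P _ _).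
by apply/seteqP; split => w' /(EB _ (path_cpath w')).
Qed.

Lemma start_as x : {ae P x, forall w, X 0 w = x}.
Proof.
apply: as_of_prob1 (diffusion_start hX x).
apply: (@observed_measurable [set f | f 0 = x]).
by apply: (@observed_coord _ _ 0 [set x]) => //=.
Qed.

End diffusion_basics.
Arguments path_cpath {R d T P X} hX w.

(** * Regularity of recurrent diffusions *)

Section recurrence.
Context {R : realType} {d : measure_display} {T : measurableType d}
  {P : R -> probability T R} {X : R -> T -> R} (hX : diffusion P X)
  (rX : recurrent P X).
Implicit Types (D : R -> R -> Prop) (E : set (R -> R)) (G : set T)
  (tau : T -> \bar R).

Lemma ae_forall (I : countType) (Q : I -> T -> Prop) x :
  (forall i, {ae P x, forall w, Q i w}) -> {ae P x, forall w, forall i, Q i w}.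
Proof.
move=> aQ; have : {ae P x, forall w, forall n : nat,
    oapp (fun i => Q i w) True (unpickle n)}.
  apply: ae_foralln => n; case: (unpickle n) => [i|] /=; first exact: aQ.
  exact: aeW.
apply: filterS => w H i; have := H (pickle i).
by rewrite pickleK.
Qed.

Lemma markov_measurable tau (t : R) : markov_time X tau ->
  measurable [set w | (tau w < t%:E)%E].
Proof.
move=> [tau0 mt]; have [t0|t0] := leP 0 t.
  exact: (natural_measurable hX (mt t t0)).
suff -> : [set w | (tau w < t%:E)%E] = set0 by [].
apply/seteqP; split => w //= /(le_lt_trans (tau0 w)).
by rewrite lte_fin ltNge (ltW t0).
Qed.

Lemma measurable_stopped_hit (D : R -> R -> Prop) (A : set (measurableTypeR R)) :
  closed_region D -> measurable A ->
  measurable (finite_time (first_time X D) `&` stopped X (first_time X D) @^-1` A).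
Proof.
move=> clD mA; have mD := markov_hit hX clD; apply: (measurable_stopped hX) => //.
  exact: mD.1.
by move=> t; exact (markov_measurable t mD).
Qed.

Lemma measurable_finite_hit (D : R -> R -> Prop) :
  closed_region D -> measurable (finite_time (first_time X D)).
Proof.
move=> clD; have := measurable_stopped_hit clD measurableT.
by rewrite preimage_setT setIT.
Qed.

Lemma measurable_restart tau G E : markov_time X tau -> prior_event X tau G ->
  observed [set s | 0 <= s] E -> measurable (G `&` finite_time tau `&`
     [set w | E (fun s => X (fine (tau w) + s) w)]).
Proof.
move=> mt pG oE; rewrite -(setIid (finite_time tau)) setIA -setIA.
apply: measurableI; first exact (measurable_prior hX mt pG).
by apply: (measurable_shift hX) => // [|t]; [exact: mt.1|exact: markov_measurable].
Qed.

Lemma restart_as x tau E : markov_time X tau -> observed [set s | 0 <= s] E ->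
  (forall y, P y [set w | E (X ^~ w)] = 1%E) ->
  {ae P x, forall w, finite_time tau w ->
     E (fun s => X (fine (tau w) + s) w)}.
Proof.
move=> mt oE PE; have pT := prior_setT mt.
have mE := measurable_restart mt pT oE.
have mF := measurable_prior hX mt pT.
have := restart hX x mt pT oE (c := 1%E) (fun w _ _ => PE _); rewrite mul1e => PFE.
have := as_of_eq_prob mF mE (@subIsetl _ _ _) PFE.
by apply: filterS => w FE fw; have [] := FE (conj I fw).
Qed.

Lemma closed_level (y : R) : closed_region (fun _ z => z = y).
Proof.
move=> t x t0 /eqP xy; exists (setT, [set z | z != y]) => /=.
  by split; [exact: filterT|exact: (open_nbhs_nbhs (conj (@open_neq _ y) xy))].
by move=> [u v] [/= _ /eqP].
Qed.

Lemma reach_as x y : {ae P x, forall w, (first_time X (fun _ z => z = y) w < +oo)%E}.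
Proof.
apply: as_of_prob1 (rX x y).
exact (observed_measurable hX (observed_finite (closed_level (y:=y)))).
Qed.

(** By continuity the path sits exactly at [y] when it leaves the closed
    half-line, and it does so by visiting the open half-line at once. *)
Lemma first_exit b f (y : R) (D := fun _ z : R => side b y < side b z) : cpath f ->
  f 0 = y -> (hit D f < +oo)%E ->
  f (fine (hit D f)) = y /\ crosses b (fun s => f (fine (hit D f) + s)).
Proof.
move=> cf f0 hf; set t := fine (hit D f).
have t0 : 0 <= t by exact: fine_hit_ge0.
have le_t : side b (f t) <= side b y.
  rewrite leNgt; apply/negP => lt_t.
  have {}t0 : 0 < t.
    by rewrite lt_neqAle t0 andbT; apply: contraTneq lt_t => <-; rewrite f0 ltxx.
  have /nbhs_ballP[e /= e0 He] := cf t (ltW t0) _ (side_gt_nbhs lt_t).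
  pose s := Num.max (t / 2) (t - e / 2).
  have s0 : 0 < s by rewrite lt_max divr_gt0.
  have st : s < t by rewrite gt_max; apply/andP; split; lra.
  have es : t - e / 2 <= s by rewrite le_max lexx orbT.
  have Ds : D s (f s).
    apply: He; last exact: ltW.
    by rewrite /ball /= ger0_norm ?subr_ge0 ?ltW//; lra.
  by have := @hit_le _ D f s s0 Ds; rewrite hit_fine// lee_fin -/t leNgt st.
have after e : 0 < e -> exists2 u, 0 < u < e & side b y < side b (f (t + u)).
  move=> e0; have : (hit D f < (t + e)%:E)%E by rewrite hit_fine// lte_fin ltrDl.
  move=> /hit_lt[s /andP[s0 st] Ds].
  have ts : t < s.
    rewrite lt_neqAle; apply/andP; split.
      by apply: contraTneq le_t => ->; rewrite -ltNge.
    by rewrite -lee_fin -hit_fine//; exact: (@hit_le _ D f).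
  by exists (s - t); rewrite ?subrKC//; apply/andP; split; lra.
have ft : f t = y.
  suff : side b (f t) = side b y by move/(can_inj (sideK b)).
  apply/eqP; rewrite eq_le le_t leNgt; apply/negP => lt_t.
  have /nbhs_ballP[e /= e0 He] := cf t t0 _ (side_lt_nbhs lt_t).
  have [u /andP[u0 ue]] := after e e0; apply/negP; rewrite -leNgt; apply/ltW/He.
    by rewrite /ball /= opprD addrA subrr sub0r normrN gtr0_norm.
  by rewrite addr_ge0// ltW.
by split => // e e0; have [u ue fu] := after e e0; exists u; rewrite // addr0 ft.
Qed.

(** Regularity.  The process leaves the closed half-line in finite time by
    recurrence; when it does, it is at [y] again and visits the open half-line
    immediately.  By the strong Markov property the probability of doing so
    from [y] is the probability of doing so at that time, namely 1. *)
Lemma prob_crosses b y : P y [set w | crosses b (X ^~ w)] = 1%E.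
Proof.
pose D := fun _ z : R => side b y < side b z; pose tau := first_time X D.
have mt : markov_time X tau.
  split => [w|t t0]; first exact: hit_ge0.
  apply: (observed_natural hX (E := [set f | (hit D f < t%:E)%E])).
  apply: (@observed_eq _ _ _ [set f | exists q : rat,
     (0 < (ratr q : R) < t) /\ side b y < side b (f (ratr q))]).
    move=> f cf; split => [/hit_lt[s /andP[s0 st] Ds]|[q [qt Dq]]]; last first.
      by apply/hit_lt; exists (ratr q).
    have /nbhs_ballP[e /= e0 He] := cf s (ltW s0) _ (side_gt_nbhs Ds).
    have : s < Num.min t (s + e) by rewrite lt_min st ltrDl e0.
    move=> /rat_in_itvoo[q]; rewrite in_itv /= lt_min => /andP[sq /andP[qt qe]].
    exists q; rewrite (lt_trans s0)//; split => //; apply: He.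
      by rewrite /ball /= ltr_distlC; apply/andP; split; lra.
    by rewrite ltW// (lt_trans s0).
  apply: observed_exists => q; apply: observed_and => /andP[q0 qt].
  apply: (@observed_coord _ _ (ratr q) [set z | side b y < side b z]).
    by rewrite /= !ltW.
  apply: open_measurable; rewrite openE => z /= yz; exact: side_gt_nbhs.
have fin : {ae P y, forall w, finite_time tau w}.
  have := reach_as y (side b (side b y + 1)); apply: filterS => w.
  rewrite /finite_time /tau /= => H.
  have [s s0 Xs] := (hit_lty _ _).1 H.
  by apply/(hit_lty D); exists s; rewrite // /D Xs sideK ltrDl.
have pG := prior_start y mt.
have := restart hX y mt pG (observed_crosses b)
   (c := P y [set w | crosses b (X ^~ w)]).
have -> : [set w | X 0 w = y] `&` finite_time tau `&`
     [set w | crosses b (fun s => X (fine (tau w) + s) w)] =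
     [set w | X 0 w = y] `&` finite_time tau.
  apply/seteqP; split => w [[X0 fw]]; first by move=> _; split.
  by split => //; exact: (first_exit (path_cpath hX w) X0 fw).2.
have -> : P y ([set w | X 0 w = y] `&` finite_time tau) = 1%E.
  apply: prob1_of_as; first exact (measurable_prior hX mt pG).
  by apply: filterS2 (start_as hX y) fin => w.
rewrite mule1 => -> // w X0 fw.
by rewrite /stopped (first_exit (path_cpath hX w) X0 fw).1.
Qed.

(** First return to [y] after time [s]; for small [s] > 0 this is a short
    positive stopping time at which a process started at [y] begins afresh. *)
Definition returns (y s : R) := fun t x : R => s <= t /\ x = y.

Lemma closed_returns y s : closed_region (returns y s).
Proof.
move=> t x t0 /not_andP[/negP|nx].
  rewrite -ltNge => ts; exists ([set u | u < s], setT) => /=.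
    by split; [exact: lt_nbhsl|exact: filterT].
  by move=> [u v] [/= us _] [/(lt_le_trans us)]; rewrite ltxx.
have := closed_level t0 nx; apply: filterS => p np [_]; exact: np.
Qed.

Lemma return_finite_as x y s : 0 < s ->
  {ae P x, forall w, (first_time X (returns y s) w < +oo)%E}.
Proof.
move=> s0; have := restart_as x (markov_constant (X:=X) (ltW s0))
  (observed_finite (closed_level (y:=y))) (fun z => rX z y).
apply: filterS => w /(_ (ltry s)) /= H.
have [u u0 Xu] := (hit_lty _ _).1 H.
apply/hit_lty; exists (s + u); first exact: addr_gt0.
by split => //; rewrite lerDl ltW.
Qed.

Lemma return_stopped y s w : 0 < s -> (first_time X (returns y s) w < +oo)%E ->
  returns y s (fine (first_time X (returns y s) w))
    (stopped X (first_time X (returns y s)) w).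
Proof.
move=> s0 fw; apply: (hit_attained (path_cpath hX w) fw).
have : s <= fine (first_time X (returns y s) w).
  rewrite -lee_fin -[X in (_ <= X)%E](hit_fine fw).
  apply/ereal_infP => _ [u [_ [su _]] <-].
  by rewrite lee_fin.
by move=> /(lt_le_trans s0); exact: closed_returns.
Qed.

(** The path is on both sides of [y] at arbitrarily small times. *)
Lemma zeros_as y : {ae P y, forall w e, 0 < e ->
  exists2 t, 0 < t < e & X t w = y}.
Proof.
have crossing b : {ae P y, forall w, crosses b (X ^~ w)}.
  exact: as_of_prob1 (observed_measurable hX (observed_crosses b)) (prob_crosses b y).
apply: filterS3 (crossing true) (crossing false) (start_as hX y) => w Ct Cf X0 e e0.
have [t1 /andP[t10 t1e] /= f1] := Ct e e0.
have [t2 /andP[t20 t2e] /= f2] := Cf e e0.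
rewrite X0 in f1 f2; rewrite ltrN2 in f2.
have cw (a c : R) : 0 < a -> {within `[a, c], continuous (X ^~ w)}.
  move=> a0; have sub : `[a, c]%classic `<=` `[0, +oo[%classic.
    by move=> t /=; rewrite !in_itv /= andbT => /andP[+ _]; apply/le_trans/ltW.
  exact: (continuous_subspaceW sub (@diffusion_continuous _ _ _ _ _ hX w)).
have [t12|t21] := leP t1 t2.
  have [|z] := IVT t12 (cw _ _ t10) (v := y).
    by rewrite ge_min le_max !(ltW f1, ltW f2) orbT.
  rewrite in_itv /= => /andP[z1 z2] Xz; exists z => //.
  by rewrite (lt_le_trans t10)// (le_lt_trans z2).
have [|z] := IVT (ltW t21) (cw _ _ t20) (v := y).
  by rewrite ge_min le_max !(ltW f1, ltW f2) orbT.
rewrite in_itv /= => /andP[z1 z2] Xz; exists z => //.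
by rewrite (lt_le_trans t20)// (le_lt_trans z2).
Qed.

End recurrence.

(** * Barriers and limits of hitting times *)

Section barriers.
Context {R : realType}.
Implicit Types (D : R -> R -> Prop) (f : R -> R) (U : R -> R -> Prop).

(** The same region, [e] units of time ahead.  It is smaller for regions that
    shrink with time. *)
Definition delay (e : R) D : R -> R -> Prop := fun t x => D (t + e) x.

Definition hitby D (s : R) f := exists2 t, 0 < t <= s & D t (f t).

Definition time_decreasing D := forall s t x, 0 < s -> s <= t -> D t x -> D s x.

Lemma closed_at_delay e D t x : closed_region D -> 0 < t + e ->
  closed_at (delay e D) t x.
Proof.
move=> clD te nD; have [[/= V W] [Vt Wx] VW] := clD _ _ te nD.
have c : (fun s : R => s + e) @ t --> t + e by apply: cvgD; [|exact: cvg_cst].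
exists ([set s | V (s + e)], W); first by split => //; exact: c Vt.
by move=> [u v] [/= Vu Wv]; exact: (VW (u + e, v)).
Qed.

Lemma closed_delay e D : closed_region D -> 0 <= e -> closed_region (delay e D).
Proof. by move=> clD e0 t x t0; apply: closed_at_delay => //; exact: ltr_wpDr. Qed.

(** At positive times, the set of points on or above the graph of a
    left-continuous increasing function with values in [0, +oo]; see
    [boundary].  Such sets are easier to perturb and to pass to the limit with
    than the functions. *)
Record barrier U := Barrier {
  barrier_mono : forall s t x y, 0 < s -> s <= t -> x <= y -> U t x -> U s y ;
  barrier_closed : closed_region U ;
  barrier_ge0 : forall t x, U t x -> 0 <= x }.

(** The barrier [U true] stops the process from above and the mirror image of
    [U false] stops it from below. *)
Definition region (U : bool -> R -> R -> Prop) t x := exists b, U b t (side b x).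

Lemma side_cvg b (x : R) : side b @ x --> side b x.
Proof. by case: b => /=; [exact: cvg_id|exact: cvgN]. Qed.

Lemma time_decreasing_region (U : bool -> R -> R -> Prop) :
  (forall b, barrier (U b)) -> time_decreasing (region U).
Proof.
by move=> bU s t x s0 st [b Ub]; exists b; exact: (barrier_mono (bU b) s0 st (lexx _)).
Qed.

Lemma closed_regionU (U : bool -> R -> R -> Prop) :
  (forall b, barrier (U b)) -> closed_region (region U).
Proof.
move=> bU t x t0 nU.
have : forall b, \forall p \near (t, x), ~ U b p.1 (side b p.2).
  move=> b; have nUb : ~ U b t (side b x) by move=> Ub; apply: nU; exists b.
  have [[/= V W] [Vt Wx] VW] := barrier_closed (bU b) t0 nUb.
  exists (V, side b @^-1` W); first by split => //; exact: side_cvg Wx.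
  by move=> [u v] [/= Vu Wv]; exact: (VW (u, side b v)).
by move=> /filter_forall; apply: filterS => p H [b]; exact: H.
Qed.

Definition stopped_at D f := f (fine (hit D f)).

(** As soon as the path hits the region it is, within any positive delay, in
    its interior: strictly beyond a level [x] that stays in the region for some
    more time [e].  A point of this kind survives small perturbations of the
    region. *)
Definition enters (U : bool -> R -> R -> Prop) f := forall s,
  (hit (region U) f < s%:E)%E ->
  exists t b x e, [/\ 0 < t < s, 0 < e, x < side b (f t) & U b (t + e) x].

(** Convergence of closed sets: interior points are eventually reached, and
    points outside have neighbourhoods that are eventually avoided. *)
Definition barrier_cvg (V : nat -> R -> R -> Prop) U :=
  (forall s t x y, U t x -> 0 < s -> s < t -> x < y ->
     \forall n \near \oo, V n s y) /\
  (forall t x, 0 < t -> ~ U t x ->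
     \forall p \near (t, x) & n \near \oo, ~ V n p.1 p.2).

Section hit_limit.
Variables (V : nat -> bool -> R -> R -> Prop) (U : bool -> R -> R -> Prop).
Hypothesis VU : forall b, barrier_cvg (fun n => V n b) (U b).
Variables (f : R -> R).
Hypotheses (cf : cpath f) (f0 : f 0 = 0) (ef : enters U f).

Lemma hit_limit_lt s : (hit (region U) f < s%:E)%E ->
  \forall n \near \oo, (hit (region (V n)) f < s%:E)%E.
Proof.
move=> /ef[t [b [x [e [/andP[t0 ts] e0 xf Ub]]]]].
have te : t < t + e by rewrite ltrDl.
have := (VU b).1 _ _ _ _ Ub t0 te xf; apply: filterS => n Vn.
by apply/hit_lt; exists t; rewrite ?t0//; exists b.
Qed.

(** If the limiting region is not met up to time [s], then by compactness the
    [n]-th region is not met on a compact interval of positive times up to [s],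
    for large [n].  It can only be met near time 0, that is near position 0. *)
Lemma hit_limit_gt s e : 0 < e -> (s%:E < hit (region U) f)%E ->
  \forall n \near \oo, (s%:E < hit (region (V n)) f)%E \/
    `|stopped_at (region (V n)) f| < e.
Proof.
move=> e0 sh.
have [s1 ss1 s1h] : exists2 s1, s < s1 & (s1%:E < hit (region U) f)%E.
  case: (hit _ _) sh (hit_ge0 (region U) f) => [r| |]//; last first.
    by move=> _ _; exists (s + 1); rewrite ?ltrDl ?ltry.
  by rewrite lte_fin => sr _; exists ((s + r) / 2); rewrite ?lte_fin; lra.
have [eta eta0 Heta] : exists2 eta, 0 < eta & forall t, 0 <= t <= eta -> `|f t| < e.
  have e0' : 0 < e by [].
  have /nbhs_ballP[r /= r0 Hr] := cf (lexx 0) (nbhsx_ballx (f 0) _ e0').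
  exists (r / 2) => [|t /andP[t0 tr]]; first exact: divr_gt0.
  have : ball (f 0) e (f t).
    by apply: Hr => //; rewrite /ball /= sub0r normrN ger0_norm//; lra.
  by rewrite /ball /= f0 sub0r normrN.
have cov t : [set` `[eta, s1]] t -> \forall t' \near t & n \near \oo,
    ~ region (V n) t' (f t').
  rewrite /= in_itv /= => /andP[et ts1].
  have t0 : 0 < t by exact: lt_le_trans et.
  have nD : ~ region U t (f t).
    move=> /(hit_le t0) /(lt_le_trans s1h).
    by rewrite lte_fin ltNge ts1.
  have : forall b, \forall p \near (t, \oo),
      0 <= p.1 -> ~ V p.2 b p.1 (side b (f p.1)).
    move=> b; have nUb : ~ U b t (side b (f t)) by move=> Ub; apply: nD; exists b.
    have [[/= A N] [[[/= B C] [Bt Cx] BC] NN] AN] := (VU b).2 _ _ t0 nUb.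
    have CC : nbhs (f t) (side b @^-1` C) by exact: side_cvg Cx.
    exists (B `&` [set t' | 0 <= t' -> C (side b (f t'))], N).
      by split => //=; apply: filterI => //; exact: (cf (ltW t0) CC).
    move=> [t' n] [/= [Bt' Ct'] Nn] t'0.
    apply: (AN ((t', side b (f t')), n)); split => //=; apply: BC.
    by split => //=; exact: Ct'.
  move=> /filter_forall H.
  have : \forall p \near (t, \oo), 0 <= p.1 /\ forall b,
       0 <= p.1 -> ~ V p.2 b p.1 (side b (f p.1)).
    apply: filterI; last exact: H.
    exists ([set t' | 0 <= t'], setT); last by move=> p [].
    split; last exact: filterT.
    by near=> t'; apply: ltW; near: t'; exact: lt_nbhsr.
  by apply: filterS => -[t' n] /= [t'0 nV] [b]; exact: nV.
have H : \forall n \near \oo, forall t, [set` `[eta, s1]] t ->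
    ~ region (V n) t (f t).
  exact: (compact_near_coveringP _).1 (@segment_compact _ eta s1) nat \oo
    (fun n t => ~ region (V n) t (f t)) _ cov.
apply: filterS H => n Hn.
have [//|hs] := ltP s%:E (hit (region (V n)) f); [by left|right].
have : (hit (region (V n)) f < s1%:E)%E by rewrite (le_lt_trans hs)// lte_fin.
move=> /hit_lt[t /andP[t0 ts1] Dt]; apply: Heta; rewrite fine_hit_ge0 /=.
have te : t < eta.
  rewrite ltNge; apply/negP => et; apply: (Hn t) Dt.
  by rewrite /= in_itv /= et ltW.
rewrite (le_trans _ (ltW te))// -lee_fin -hit_fine ?hit_le//.
by apply/hit_lty; exists t.
Unshelve. all: by end_near. Qed.

Lemma hit_limit_stopped (O : set R) e : 0 < e -> (hit (region U) f < +oo)%E ->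
  nbhs (stopped_at (region U) f) O ->
  \forall n \near \oo, (hit (region (V n)) f < +oo)%E /\
    (O (stopped_at (region (V n)) f) \/ `|stopped_at (region (V n)) f| < e).
Proof.
move=> e0 hf; rewrite /stopped_at; set t := fine _ => Ot.
have t0 : 0 <= t by exact: fine_hit_ge0.
have /nbhs_ballP[r /= r0 Hr] := cf t0 Ot.
have hlt : (hit (region U) f < (t + r)%:E)%E by rewrite hit_fine// lte_fin ltrDl.
have hgt : ((t - r)%:E < hit (region U) f)%E.
  by rewrite hit_fine// lte_fin ltrBlDr ltrDl.
apply: filterS2 (hit_limit_lt hlt) (hit_limit_gt e0 hgt) => n hn gn.
have hnf : (hit (region (V n)) f < +oo)%E by rewrite (lt_trans hn)// ltry.
split => //; case: gn => [gn|]; [left|by right].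
rewrite hit_fine// lte_fin in hn; rewrite hit_fine// lte_fin in gn.
apply: Hr; last exact: fine_hit_ge0.
by rewrite /ball /= ltr_distlC; apply/andP; split; lra.
Qed.

End hit_limit.
End barriers.

(** * A diffusion enters every region that it hits *)

Section entering.
Context {R : realType} {d : measure_display} {T : measurableType d}
  {P : R -> probability T R} {X : R -> T -> R} (hX : diffusion P X)
  (rX : recurrent P X).
Implicit Types (D : R -> R -> Prop) (E : set (R -> R)) (G : set T)
  (tau : T -> \bar R).

Local Notation ret n := (first_time X (returns 0 n.+1%:R^-1)).

Lemma ret_gt0 n : 0 < n.+1%:R^-1 :> R. Proof. by rewrite invr_gt0 ltr0n. Qed.

Lemma markov_ret n : markov_time X (ret n).
Proof. exact: (markov_hit hX (@closed_returns _ 0 n.+1%:R^-1)). Qed.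

Lemma ret_stopped n w : finite_time (ret n) w -> stopped X (ret n) w = 0.
Proof. by move=> /(return_stopped hX (ret_gt0 n))[]. Qed.

Lemma ret_ge n w : finite_time (ret n) w -> n.+1%:R^-1 <= fine (ret n w).
Proof. by move=> /(return_stopped hX (ret_gt0 n))[]. Qed.

(** Zeros of the path accumulate at time 0. *)
Lemma ret_small : {ae P 0, forall w (e : R), 0 < e ->
  \forall n \near \oo, (ret n w < e%:E)%E}.
Proof.
apply: filterS (zeros_as hX rX 0) => w Z e e0.
have [t /andP[t0 te] Xt] := Z e e0.
have : \forall n \near \oo, n.+1%:R^-1 < t :> R := near_infty_natSinv_lt (PosNum t0).
apply: filterS => n nt.
apply: (@le_lt_trans _ _ t%:E); last by rewrite lte_fin.
by apply: hit_le => //; split => //; exact: ltW.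
Qed.

Lemma observed_nohit D s : closed_region D ->
  observed [set s | 0 <= s] [set f | ~ hitby D s f].
Proof.
move=> clD; apply: (@observedC _ _ (hitby D s)).
by apply: observed_sub (observed_hit_le s clD) => u /andP[].
Qed.

(** Let [H] say that no delayed region is hit before [s], and let [T] be a
    short return time to 0.  The path restarted at [T] has the same law, so
    [H] is as likely for it; but if it satisfies [H], then the original path
    avoids [D] between [T] and [T + s], because by time [T] the region has
    shrunk at least as much as by some delay 1/(n+1) <= [T].  As [T] tends to 0
    this shows that [H] is not more likely than avoiding [D] up to [s]. *)
Lemma delayed_hit_as D s : closed_region D -> time_decreasing D ->
  {ae P 0, forall w, hitby D s (X ^~ w) ->
     exists n, hitby (delay n.+1%:R^-1 D) s (X ^~ w)}.
Proof.
move=> clD decD.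
pose N : set (R -> R) := [set f | ~ hitby D s f].
pose H : set (R -> R) := [set f | forall n, ~ hitby (delay n.+1%:R^-1 D) s f].
have oN : observed [set s | 0 <= s] N by exact: observed_nohit.
have oH : observed [set s | 0 <= s] H.
  apply: observed_forall => n; apply: observed_nohit; exact: closed_delay.
pose mN := observed_measurable hX oN; pose mH := observed_measurable hX oH.
pose E n : set T := [set w | finite_time (ret n) w /\
  H (fun s => X (fine (ret n w) + s) w)].
have mE n : measurable (E n).
  have := measurable_restart hX (markov_ret n) (prior_setT (markov_ret n)) oH.
  by rewrite setTI.
have PE n : P 0 (E n) = P 0 [set w | H (X ^~ w)].
  have := restart hX 0 (markov_ret n) (prior_setT (markov_ret n)) oH
    (c := P 0 [set w | H (X ^~ w)]).
  rewrite setTI (_ : P 0 (finite_time (ret n)) = 1%E) ?mule1.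
    by apply=> w _ fw; rewrite ret_stopped.
  apply: prob1_of_as; last exact: return_finite_as (ret_gt0 n).
  by have := measurable_prior hX (markov_ret n) (prior_setT (markov_ret n)); rewrite setTI.
have NH f : N f -> H f.
  move=> Nf n [t ts Dt]; apply: Nf; exists t => //; case/andP: ts => t0 _.
  by apply: (decD _ _ _ t0 _ Dt); rewrite lerDl ltW// ret_gt0.
have PNH : P 0 [set w | N (X ^~ w)] = P 0 [set w | H (X ^~ w)].
  apply/eqP; rewrite eq_le le_measure ?inE//=; last by move=> w; exact: NH.
  have : (P 0 (~` [set w | N (X ^~ w)]) <= 1 - P 0 [set w | H (X ^~ w)])%E.
    apply: (le_prob_eventually (B := fun n => ~` E n)).
    - exact: measurableC.
    - by move=> n; exact: measurableC.
    - apply: filterS ret_small => w small /= /contrapT[t /andP[t0 ts] Dt].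
      have := small t t0; apply: filterS => n rt [fw Hn]; apply: (Hn n).
      have {}rt : fine (ret n w) < t.
        by rewrite -lte_fin fineK// ge0_fin_numE//; exact: hit_ge0.
      move: (fine _) (ret_ge fw) rt => r rn rt.
      exists (t - r).
        by rewrite subr_gt0 rt lerBlDr (le_trans ts)// lerDl (le_trans _ rn).
      rewrite /delay subrKC; apply: (decD _ t) => //.
        by rewrite addr_gt0 ?subr_gt0// ret_gt0.
      by rewrite -[leRHS](subrK r) lerD2l.
    - by apply: nearW => n; rewrite probability_setC// PE.
  rewrite probability_setC//.
  have fN : P 0 [set w | N (X ^~ w)] \is a fin_num by exact: fin_num_measure.
  have fH : P 0 [set w | H (X ^~ w)] \is a fin_num by exact: fin_num_measure.
  by rewrite -(fineK fN) -(fineK fH) -!EFinB !lee_fin; lra.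
have HN : [set w | N (X ^~ w)] `<=` [set w | H (X ^~ w)] by move=> w; exact: NH.
apply: filterS (as_of_eq_prob mH mN HN PNH) => w HNw hw.
apply: contrapT => nex; apply: HNw hw => n hn; apply: nex; by exists n.
Qed.

(** If the path hits the region before [s], it also hits a delayed region
    before [s].  At that time it is at a point that belongs to the region for
    some more time, and it crosses the level of this point immediately. *)
Lemma enters_as (U : bool -> R -> R -> Prop) : (forall b, barrier (U b)) ->
  {ae P 0, forall w, enters U (X ^~ w)}.
Proof.
move=> bU; have clU := closed_regionU bU; have decU := time_decreasing_region bU.
pose D n := delay n.+1%:R^-1 (region U).
have clD n : closed_region (D n) by exact: closed_delay.
have crossing : {ae P 0, forall w, forall nb : nat * bool,
    (hit (D nb.1) (X ^~ w) < +oo)%E ->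
    crosses nb.2 (fun s => X (fine (hit (D nb.1) (X ^~ w)) + s) w)}.
  apply: ae_forall => -[n b] /=.
  exact: (restart_as hX 0 (markov_hit hX (clD n)) (observed_crosses b)
    (prob_crosses hX rX b)).
have delayed : {ae P 0, forall w, forall q : rat, hitby (region U) (ratr q) (X ^~ w) ->
     exists n, hitby (D n) (ratr q) (X ^~ w)}.
  by apply: ae_forall => q; exact: delayed_hit_as.
apply: filterS2 crossing delayed => w cr de s /hit_lt[t /andP[t0 ts] Dt].
have /rat_in_itvoo[q] := ts; rewrite in_itv /= => /andP[tq qs].
have [|n [u /andP[u0 uq] Du]] := de q; first by exists t; rewrite // t0 ltW.
set r := hit (D n) (X ^~ w); have fr : (r < +oo)%E by apply/hit_lty; exists u.
have rs : fine r < s.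
  rewrite (le_lt_trans _ qs)// (le_trans _ uq)// -lee_fin -hit_fine//.
  exact: hit_le.
have r0 : 0 <= fine r by exact: fine_hit_ge0.
have [b Ub] : D n (fine r) (X (fine r) w).
  apply: (hit_attained (path_cpath hX w) fr); apply: closed_at_delay => //.
  by rewrite ltr_wpDl// ret_gt0.
have e0 : 0 < Num.min (s - fine r) (n.+1%:R^-1) by rewrite lt_min subr_gt0 rs ret_gt0.
have [v /andP[v0]] := cr (n, b) fr _ e0; rewrite lt_min addr0 => /andP[vs vn] Xv.
exists (fine r + v), b, (side b (X (fine r) w)), (n.+1%:R^-1 - v).
split => //; last by rewrite -addrA subrKC.
- by apply/andP; split; [exact: ltr_wpDl|lra].
- by rewrite subr_gt0.
Qed.

Lemma measurable_gt0 tau : markov_time X tau -> measurable [set w | (0 < tau w)%E].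
Proof.
move=> mt.
suff -> : [set w | (0 < tau w)%E] = \bigcup_n ~` [set w | (tau w < n.+1%:R^-1%:E)%E].
  by apply: bigcup_measurable => n _; apply: measurableC; exact: (markov_measurable hX _ mt).
apply/seteqP; split => w /=.
  move=> t0; suff [n nt] : exists n, ((n.+1%:R^-1 : R)%:E <= tau w)%E.
    by exists n => //=; apply/negP; rewrite -leNgt.
  case: (tau w) t0 => [r|_|]//; last by exists 0; rewrite leey.
  by rewrite lte_fin => /small_nat[n nr]; exists n; rewrite lee_fin ltW.
move=> [n _ /= /negP]; rewrite -leNgt; apply: lt_le_trans.
by rewrite lte_fin ret_gt0.
Qed.

(** With positive probability the path returns to 0 before hitting [D], and
    takes a time at least 1/(n+1) for that.  Afterwards it starts afresh
    with a smaller region to avoid, so this can be iterated. *)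
Lemma nohit_gt0 D t : closed_region D -> time_decreasing D ->
  (0 < P 0 [set w | (0 < first_time X D w)%E])%E ->
  (0 < P 0 [set w | ~ hitby D t (X ^~ w)])%E.
Proof.
move=> clD decD P0.
have mD := markov_hit hX clD.
have mlt n : measurable ([set w | (ret n w < first_time X D w)%E] `&` finite_time (ret n)).
  exact (measurable_prior hX (markov_ret n) (prior_lt (markov_ret n) mD)).
have [n Pn] : exists n, (0 < P 0%R
    ([set w | (ret n w < first_time X D w)%E] `&` finite_time (ret n)))%E.
  apply/not_existsP => H; move: P0; apply/negP; rewrite -leNgt.
  apply: (le_prob_eventually (B := fun n =>
    [set w | (ret n w < first_time X D w)%E] `&` finite_time (ret n))) => //.
  - exact: measurable_gt0.
  - apply: filterS ret_small => w small /= t0.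
    have [e e0 et] : exists2 e : R, 0 < e & (e%:E <= first_time X D w)%E.
      case: (first_time X D w) t0 => [r r0|_|]//; last by exists 1; rewrite ?leey.
      by exists r => //; rewrite -lte_fin.
    apply: filterS (small e e0) => n rn; split; first exact: lt_le_trans et.
    by apply: lt_trans rn _; exact: ltry.
  - by apply: nearW => n; rewrite leNgt; apply/negP/H.
pose nohit s := [set w | ~ hitby D s (X ^~ w)].
have mnohit s : measurable (nohit s) := observed_measurable hX (observed_nohit s clD).
have step s : (0 < P 0%R (nohit s))%E -> (0 < P 0%R (nohit (s + n.+1%:R^-1)%R))%E.
  move=> Ps; have pG := prior_lt (markov_ret n) mD.
  have := restart hX 0 (markov_ret n) pG (observed_nohit s clD) (c := P 0 (nohit s)).
  have : (0 < P 0%R (nohit s) * P 0%R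
    ([set w | (ret n w < first_time X D w)%E] `&` finite_time (ret n)))%E.
    exact: mule_gt0.
  move=> /[swap] <-; last by move=> w _ fw; rewrite ret_stopped.
  move=> /lt_le_trans; apply; apply: le_measure; rewrite ?inE//.
    exact (measurable_restart hX (markov_ret n) pG (observed_nohit s clD)).
  move=> w [[/= rD fw] nh] [t' /andP[t'0 t's] Dt'].
  have [t'r|rt'] := leP t' (fine (ret n w)).
    have : (first_time X D w <= t'%:E)%E by exact: hit_le.
    move=> /(lt_le_trans rD); rewrite ltNge => /negP; apply.
    by rewrite -[X in (_ <= X)%E]fineK ?lee_fin// ge0_fin_numE//; exact: hit_ge0.
  apply: nh; exists (t' - fine (ret n w)).
    rewrite subr_gt0 rt' lerBlDr (le_trans t's)// lerD2l; exact: ret_ge.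
  rewrite subrKC; apply: decD Dt'; first by rewrite subr_gt0.
  by rewrite gerBl//; exact: fine_hit_ge0.
have iter m : (0 < P 0%R (nohit (m%:R * n.+1%:R^-1)%R))%E.
  elim: m => [|m IH]; last by rewrite -natr1 mulrDl mul1r; exact: step.
  rewrite mul0r (_ : nohit 0 = setT) ?probability_setT ?lte_fin//.
  apply/seteqP; split => // w _ [s /andP[s0 /(lt_le_trans s0)]].
  by rewrite ltxx.
have [m tm] : exists m, t <= m%:R * n.+1%:R^-1.
  exists (Num.bound `|t * n.+1%:R|); rewrite ler_pdivlMr ?ltr0n//.
  by rewrite (le_trans (ler_norm _))// ltW// archi_boundP.
apply: lt_le_trans (iter m) _; apply: le_measure; rewrite ?inE//; try exact: mnohit.
move=> w nh [s /andP[s0 st] Ds]; apply: nh; exists s => //.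
by rewrite s0 (le_trans st).
Qed.

End entering.

(** * Subsequences and barriers with finitely many levels *)

Section selection.

(** A diagonal argument.  The terms [phi n] are chosen in a decreasing sequence
    of infinite sets on which more and more columns of [u] are constant.  The
    map [phi] need not increase, only to dominate the identity. *)
Lemma bool_selection (K : countType) (u : nat -> K -> bool) :
  exists phi : nat -> nat, (forall n, (n <= phi n)%N) /\
    forall k, exists v, \forall n \near \oo, u (phi n) k = v.
Proof.
pose u' n k := oapp (u n) true (unpickle k).
pose infinite (S : set nat) := forall n, exists2 m, (n <= m)%N & S m.
have split_inf S k : infinite S -> ~ infinite (S `&` [set m | u' m k = true]) ->
    infinite (S `&` [set m | u' m k = false]).
  move=> iS /existsNP[n0 nn0] n.
  have [m nm Sm] := iS (maxn n0 n); move: nm; rewrite geq_max => /andP[n0m nm].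
  exists m => //; split => //=; apply: contra_notF nn0 => um.
  by exists m.
pose next k S := if pselect (infinite (S `&` [set m | u' m k = true]))
  then S `&` [set m | u' m k = true] else S `&` [set m | u' m k = false].
pose S := fix S n := if n is k.+1 then next k (S k) else [set: nat].
have iS n : infinite (S n).
  elim: n => [|k IH] /=; first by move=> n; exists n.
  by rewrite /next; case: pselect => // nI; exact: split_inf.
have SS m n : (m <= n)%N -> S n `<=` S m.
  elim: n => [|n IH]; first by rewrite leqn0 => /eqP ->.
  rewrite leq_eqVlt => /predU1P[->//|]; rewrite ltnS => mn x /= Sx.
  by apply: (IH mn); move: Sx; rewrite /= /next; case: pselect => ? [].
have /choice[phi Hphi] : forall n, exists m, (n <= m)%N /\ S n m.
  by move=> n; have [m] := iS n n; exists m.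
exists phi; split => [n|k]; first by have [] := Hphi n.
have [v Sv] : exists v, S (pickle k).+1 `<=` [set m | u m k = v].
  rewrite /= /next; case: pselect => ?; [exists true|exists false] => m [_] /=;
  by rewrite /u' pickleK.
exists v; exists (pickle k).+1 => // n /= kn; apply: Sv.
by apply: (SS _ n) => //; have [] := Hphi n.
Qed.

Lemma real_selection (R : realType) (I : finType) (K : R) (a : nat -> I -> R) :
  (forall n i, 0 <= a n i <= K) ->
  exists phi : nat -> nat, (forall n, (n <= phi n)%N) /\
    exists b : I -> R, forall i, a (phi n) i @[n --> \oo] --> b i.
Proof.
move=> aK; have [phi [phin H]] :=
  bool_selection (fun n (iq : I * rat) => ratr iq.2 < a n iq.1).
exists phi; split => //.
pose B i := [set x | \forall n \near \oo, x < a (phi n) i].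
have hB i : has_sup (B i).
  split.
    exists (- 1); apply: nearW => n; have /andP[a0 _] := aK (phi n) i.
    by rewrite (lt_le_trans _ a0)// ltrN10.
  exists K => x [N _ HN]; have /andP[_ aKn] := aK (phi N) i.
  by rewrite (le_trans _ aKn)// ltW// HN /=.
exists (fun i => sup (B i)) => i; apply/cvgrPdist_lt => e e0.
have [x Bx xe] := sup_adherent e0 (hB i).
have /rat_in_itvoo[q] : sup (B i) < sup (B i) + e by rewrite ltrDl.
rewrite in_itv /= => /andP[bq qe].
have [v Hv] := H (i, q).
have {}Hv : \forall n \near \oo, (ratr q < a (phi n) i) = false.
  case: v Hv => // Hv; have : B i (ratr q) by [].
  by move=> /(sup_upper_bound (hB i)); rewrite leNgt bq.
apply: filterS2 Bx Hv => n xa /negbT; rewrite -leNgt => aq.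
by rewrite ltr_distlC; apply/andP; split; lra.
Qed.

End selection.

Section levels.
Context {R : realType} {I : finType} (s : I -> bool) (l : I -> R).
Hypothesis l0 : forall i, 0 < l i.
Implicit Types (a : I -> R) (f : R -> R).

(** The barrier that stops at level [l i] up to time [a i].  The durations are
    independent of each other: the barrier follows the lowest level whose
    time has not expired. *)
Definition levels a b (t x : R) := exists i, [/\ s i = b, t <= a i & l i <= x].

Definition point i := side (s i) (l i).

Lemma closed_levels a b t x : closed_at (levels a b) t x.
Proof.
move=> nL; have : forall i, \forall p \near (t, x),
    ~ [/\ s i = b, p.1 <= a i & l i <= p.2].
  move=> i; have /not_and3P[nsi|/negP|/negP] :
      ~ [/\ s i = b, t <= a i & l i <= x] by move=> ?; apply: nL; exists i.
  - by exists (setT, setT) => [|p _ []//]; split; exact: filterT.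
  - rewrite -ltNge => ait; exists ([set u | a i < u], setT) => /=.
      by split; [exact: lt_nbhsr|exact: filterT].
    by move=> [u v] [/= au _] [_]; rewrite leNgt au.
  - rewrite -ltNge => lix; exists (setT, [set u | u < l i]) => /=.
      by split; [exact: filterT|exact: lt_nbhsl].
    by move=> [u v] [/= _ lv] [_ _]; rewrite leNgt lv.
by move=> /filter_forall; apply: filterS => p np [i]; exact: np.
Qed.

Lemma barrier_levels a b : barrier (levels a b).
Proof.
split => [u t x y u0 ut xy [i [si ti lx]]|t x _|t x [i [_ _]]].
- by exists i; rewrite (le_trans ut)// (le_trans lx).
- exact: closed_levels.
- by apply: le_trans; exact: ltW.
Qed.

Lemma levels_cvg (a : nat -> I -> R) c b :
  (forall i, a n i @[n --> \oo] --> c i) ->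
  barrier_cvg (fun n => levels (a n) b) (levels c b).
Proof.
move=> ac; split => [u t x y [i [si ti lx]] u0 ut xy|t x t0 nL].
  have : \forall n \near \oo, u < a n i by exact: (ac i _ (lt_nbhsr (lt_le_trans ut ti))).
  apply: filterS => n un; exists i; split => //; first exact: ltW.
  by rewrite (le_trans lx)// ltW.
have : forall i, \forall p \near (t, x) & n \near \oo,
    ~ [/\ s i = b, p.1 <= a n i & l i <= p.2].
  move=> i; have /not_and3P[nsi|/negP|/negP] :
      ~ [/\ s i = b, t <= c i & l i <= x] by move=> ?; apply: nL; exists i.
  - by exists (setT, setT) => [|p _ []//]; split; exact: filterT.
  - rewrite -ltNge => cit; pose m := (c i + t) / 2.
    have cm : c i < m by rewrite /m; lra.
    have mt : m < t by rewrite /m; lra.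
    exists ([set p | m < p.1], [set n | a n i < m]) => /=.
      split; last exact: (ac i _ (lt_nbhsl cm)).
      exists ([set u | m < u], setT) => /=.
        by split; [exact: lt_nbhsr|exact: filterT].
      by move=> [u v] [].
    by move=> [[u v] n] [/= mu am] [_]; rewrite leNgt (lt_trans am).
  - rewrite -ltNge => lix; exists ([set p | p.2 < l i], setT) => /=.
      split; last exact: filterT.
      exists (setT, [set u | u < l i]) => /=.
        by split; [exact: filterT|exact: lt_nbhsl].
      by move=> [u v] [].
    by move=> [[u v] n] [/= lv _] [_ _]; rewrite leNgt lv.
by move=> /filter_forall; apply: filterS => p np [i]; exact: np.
Qed.

Lemma point_neq0 i : point i != 0.
Proof. by rewrite /point; case: (s i); rewrite /= ?oppr_eq0 gt_eqF. Qed.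

Lemma norm_point i : `|point i| = l i.
Proof. by rewrite /point; case: (s i); rewrite /= ?normrN gtr0_norm. Qed.

(** A path started at 0 cannot jump over a level, so it stops at the lowest
    level that is still active. *)
Lemma stopped_level a f (D := region (levels a)) : cpath f -> f 0 = 0 ->
  (hit D f < +oo)%E ->
  exists2 i, fine (hit D f) <= a i & stopped_at D f = point i.
Proof.
move=> cf f0 hf; rewrite /stopped_at; set t := fine (hit D f).
have t0 : 0 <= t by exact: fine_hit_ge0.
have [b [i [si ti lf]]] : D t (f t).
  apply: (hit_attained cf hf) => nD.
  have : forall b, \forall p \near (t, f t), ~ levels a b p.1 (side b p.2).
    move=> b; have nL : ~ levels a b t (side b (f t)) by move=> L; apply: nD; exists b.
    have [[/= V W] [Vt Wx] VW] := closed_levels nL.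
    exists (V, side b @^-1` W); first by split => //; exact: side_cvg Wx.
    by move=> [u v] [/= Vu Wv]; exact: (VW (u, side b v)).
  by move=> /filter_forall; apply: filterS => p H [b]; exact: H.
exists i => //; rewrite /point si -[LHS](sideK b); congr side.
apply/eqP; rewrite eq_le lf andbT leNgt; apply/negP => ltf.
have {}t0 : 0 < t.
  rewrite lt_neqAle t0 andbT; apply: contraTneq lf => <-.
  by rewrite f0 -ltNge; case: (b); rewrite /= ?oppr0.
have /nbhs_ballP[e /= e0 He] := cf t (ltW t0) _ (side_gt_nbhs ltf).
pose u := Num.max (t / 2) (t - e / 2).
have u0 : 0 < u by rewrite lt_max divr_gt0.
have ut : u < t by rewrite gt_max; apply/andP; split; lra.
have eu : t - e / 2 <= u by rewrite le_max lexx orbT.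
have Du : D u (f u).
  exists b, i; split => //; first by rewrite (le_trans (ltW ut)).
  apply/ltW/He; last exact: ltW.
  by rewrite /ball /= ger0_norm ?subr_ge0 ?ltW//; lra.
by have := @hit_le _ D f u u0 Du; rewrite hit_fine// lee_fin -/t leNgt ut.
Qed.

Lemma small_level : exists2 e, 0 < e & forall i, e <= l i.
Proof.
have : \forall e \near 0^'+, forall i, e <= l i.
  by apply: filter_forall => i; exact: nbhs_right_le.
move=> H; have : \forall e \near 0^'+, 0 < e /\ forall i, e <= l i.
  by apply: filterI => //; exact: nbhs_right_gt.
by move=> /filter_ex[e [e0 el]]; exists e.
Qed.

End levels.

(** * Embedding finitely many masses *)

Section finitely_many_levels.
Context {R : realType} {d : measure_display} {T : measurableType d}
  {P : R -> probability T R} {X : R -> T -> R} (hX : diffusion P X)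
  (rX : recurrent P X).
Context {I : finType} (s : I -> bool) (l : I -> R).
Hypothesis l0 : forall i, 0 < l i.
Local Notation pt := (point s l).
Hypothesis pt_inj : injective pt.
Implicit Types (a c : I -> R).

Local Notation tau a := (first_time X (region (levels s l a))).

Definition stops_at a i : set T :=
  finite_time (tau a) `&` stopped X (tau a) @^-1` [set pt i].

Lemma closed_region_levels a : closed_region (region (levels s l a)).
Proof. by apply: closed_regionU => b; exact: barrier_levels. Qed.

Lemma measurable_stops_at a i : measurable (stops_at a i).
Proof.
exact (measurable_stopped_hit hX (@closed_region_levels a) (measurable_set1 _)). Qed.

Lemma stops_at_some a w : X 0 w = 0 -> finite_time (tau a) w ->
  exists i, fine (tau a w) <= a i /\ stops_at a i w.
Proof.
move=> X0 fw; have [i ti Xi] := stopped_level l0 (path_cpath hX w) X0 fw.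
by exists i.
Qed.

Lemma stops_at_time a i w : X 0 w = 0 -> stops_at a i w -> fine (tau a w) <= a i.
Proof.
move=> X0 [fw Xi]; have [j [tj [_ Xj]]] := stops_at_some X0 fw.
suff -> : i = j by [].
by apply: pt_inj; rewrite -Xi -Xj.
Qed.

Section continuity.
Variables (a : nat -> I -> R) (c : I -> R).
Hypothesis ac : forall i, a n i @[n --> \oo] --> c i.

Let region_cvg b : barrier_cvg (fun n => levels s l (a n) b) (levels s l c b).
Proof. exact: levels_cvg. Qed.

Lemma stops_at_eventually : {ae P 0, forall w j, stops_at c j w ->
  \forall n \near \oo, stops_at (a n) j w}.
Proof.
have bU b : barrier (levels s l c b) by exact: barrier_levels.
apply: filterS2 (enters_as hX rX bU) (start_as hX 0) => w ent X0 j [fw Xj].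
have [e e0 el] := small_level l0.
pose O := [set y | forall k, pt k = y -> k = j].
have nO : \forall y \near pt j, forall k, pt k = y -> k = j.
  apply: (@filter_forall _ I (fun k y => pt k = y -> k = j)
    (nbhs (pt j)) (nbhs_filter _)) => k.
  have [->|kj] := eqVneq k j; first by apply: filterE.
  have jk : pt j != pt k by rewrite eq_sym; apply: contra_neq kj; exact: pt_inj.
  have H : nbhs (pt j) [set y | y != pt k].
    exact: open_nbhs_nbhs (conj (@open_neq _ (pt k)) jk).
  by apply: filterS H => y /= yk kE; move: yk; rewrite kE eqxx.
have {}nO : nbhs (stopped X (tau c) w) O by rewrite Xj; exact: nO.
have := hit_limit_stopped region_cvg (path_cpath hX w) X0 ent e0 fw nO.
apply: filterS => n [fn H].
have [k [_ [_ Xk]]] := stops_at_some X0 fn; case: H => [Ok|lte].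
  by split => //; rewrite /preimage /= Xk (Ok k).
have : `|stopped X (tau (a n)) w| < e by exact: lte.
by rewrite Xk norm_point// ltNge el.
Qed.

Lemma stops_at_eventually_not K : (forall n i, a n i <= K) ->
  {ae P 0, forall w j, ~ stops_at c j w ->
    \forall n \near \oo, ~ stops_at (a n) j w}.
Proof.
move=> aK; have bU b : barrier (levels s l c b) by exact: barrier_levels.
apply: filterS3 stops_at_eventually (enters_as hX rX bU) (start_as hX 0).
move=> w ev ent X0 j nj.
have [fw|nfw] := pselect (finite_time (tau c) w).
  have [k [_ sk]] := stops_at_some X0 fw; apply: filterS (ev k sk) => n [_ Xk] [_ Xj].
  by apply: nj; rewrite (_ : j = k)//; apply: pt_inj; rewrite -Xk -Xj.
have [e e0 el] := small_level l0.
have gtK : (K%:E < hit (region (levels s l c)) (X ^~ w))%E.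
  by rewrite ltNge; apply/negP => hK; apply: nfw; apply: le_lt_trans hK (ltry _).
have := hit_limit_gt region_cvg (path_cpath hX w) X0 e0 gtK.
apply: filterS => n H sj; have tK := stops_at_time X0 sj; case: sj => [fn Xj].
case: H => [|lte]; last first.
  have : `|stopped X (tau (a n)) w| < e by exact: lte.
  by rewrite Xj norm_point// ltNge el.
by rewrite hit_fine// lte_fin ltNge (le_trans tK).
Qed.

End continuity.

(** Enlarging the region at level [i] only diverts paths to the point [i]: a
    path that still stops at another point [j] was not stopped before, and
    would have stopped there in the smaller region as well. *)
Lemma stops_at_lower a c i j w : (forall k, k != i -> c k = a k) -> a i <= c i ->
  j != i -> X 0 w = 0 -> stops_at c j w -> stops_at a j w.
Proof.
move=> ca aci ji X0 sj; have tj := stops_at_time X0 sj; case: sj => [fw Xj].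
set t := fine (tau c w) in tj.
have t0 : 0 < t.
  rewrite lt_neqAle (fine_hit_ge0 _ (X ^~ w)) andbT; apply/eqP => t0.
  have := point_neq0 s l0 j; rewrite -Xj /stopped /= -/t -t0 X0 eqxx //.
have Da : region (levels s l a) t (X t w).
  exists (s j), j; split => //; first by rewrite -ca.
  by rewrite [X t w]Xj /point sideK.
have sub u x : region (levels s l a) u x -> region (levels s l c) u x.
  move=> [b [k [sk uk lk]]]; exists b, k; split => //.
  have [ki|ki] := eqVneq k i; last by rewrite ca.
  by rewrite ki in uk *; exact: le_trans aci.
have fa : finite_time (tau a) w by apply/hit_lty; exists t.
have ac : (tau c w <= tau a w)%E.
  apply/ereal_infP => _ [u [u0 Du] <-].
  by apply: (@hit_le _ _ (X ^~ w)) => //; exact: sub.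
have : tau a w = tau c w.
  apply/eqP; rewrite eq_le ac andbT [leRHS](hit_fine fw).
  exact: (@hit_le _ _ (X ^~ w)).
by move=> E; split => //; rewrite /stopped /= E.
Qed.

(** The durations for which no point receives more than its share [p i].  The
    bound [K] makes the set of durations compact; the second condition keeps
    the levels without mass out of the barrier. *)
Definition admissible (p : I -> R) K a := forall i,
  [/\ 0 <= a i <= K, p i = 0 -> a i = 0 & (P 0 (stops_at a i) <= (p i)%:E)%E].

Lemma admissible_limit p K (a : nat -> I -> R) c : (forall n, admissible p K (a n)) ->
  (forall i, a n i @[n --> \oo] --> c i) -> admissible p K c.
Proof.
move=> adm ac i; have cvg_a : cvg (a n i @[n --> \oo]) by apply/cvg_ex; exists (c i).
have lim_a : lim (a n i @[n --> \oo]) = c i by exact/cvg_lim.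
split => [|pi0|].
- rewrite -lim_a limr_ge ?limr_le//; apply: nearW => n;
  by have [/andP[]] := adm n i.
- apply/eqP; rewrite eq_le -lim_a limr_ge ?limr_le//; apply: nearW => n;
  by have [_ /(_ pi0)->] := adm n i.
- apply: (le_prob_eventually (B := fun n => stops_at (a n) i)).
  + exact: measurable_stops_at.
  + by move=> n; exact: measurable_stops_at.
  + by apply: filterS (stops_at_eventually ac) => w; exact.
  + by apply: nearW => n; have [] := adm n i.
Qed.

Lemma reach_by e : 0 < e -> exists2 K, 0 <= K & forall i,
  ((1 - e)%:E <= P 0 [set w | (first_time X (fun _ z => z = pt i) w < K%:E)%E])%E.
Proof.
move=> e0; pose h i := first_time X (fun _ z => z = pt i).
have mh i (t : R) : measurable [set w | (h i w < t%:E)%E].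
  exact (markov_measurable hX t (markov_hit hX (@closed_level _ (pt i)))).
have /choice[k Hk] : forall i, exists n : nat,
    ((1 - e)%:E <= P 0 [set w | (h i w < n%:R%:E)%E])%E.
  move=> i; apply/not_existsP => H.
  have : (P 0 [set w | (h i w < +oo)%E] <= (1 - e)%:E)%E.
    apply: (le_prob_eventually (B := fun n : nat => [set w | (h i w < n%:R%:E)%E])) => //.
    - exact (measurable_finite_hit hX (@closed_level _ (pt i))).
    - apply: aeW => w /= hf; exists (Num.bound (fine (h i w))) => // n /= bn.
      rewrite [ltLHS](hit_fine hf) lte_fin (lt_le_trans (archi_boundP (fine_hit_ge0 _ _)))//.
      by rewrite ler_nat.
    - by apply: nearW => n; apply/ltW; rewrite ltNge; apply/negP/H.
  rewrite (prob1_of_as _ (reach_as hX rX 0 (pt i))).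
    by rewrite lee_fin; lra.
  exact (measurable_finite_hit hX (@closed_level _ (pt i))).
exists (\sum_i (k i)%:R) => [|i]; first by apply: sumr_ge0 => i _; exact: ler0n.
apply: le_trans (Hk i) _.
apply: le_measure; rewrite ?inE; [exact: mh|exact: mh|].
move=> w /= /lt_le_trans; apply; rewrite lee_fin (bigD1 i)//= lerDl.
by apply: sumr_ge0 => j _; exact: ler0n.
Qed.

(** By compactness and continuity there are admissible durations [c] with the
    largest sum.  If a point [i] received strictly less than [p i] while
    [c i < K], then [c i] could be increased a little: the mass at [i] varies
    continuously, and the others can only decrease.  Hence either every point
    receives its share, or some level is active up to time [K], by which it is
    reached with probability at least [1 - e]. *)
Lemma sub_embedding (p : I -> R) e : (forall i, 0 <= p i) -> 0 < e -> exists a,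
  [/\ forall i, 0 <= a i, forall i, p i = 0 -> a i = 0,
      forall i, (P 0 (stops_at a i) <= (p i)%:E)%E &
      (\sum_i (p i)%:E <= P 0 (finite_time (tau a)))%E \/
      ((1 - e)%:E <= P 0 (finite_time (tau a)))%E].
Proof.
move=> p0 e0; have [K K0 HK] := reach_by e0.
have mS a i := measurable_stops_at a i.
have mfin a : measurable (finite_time (tau a)).
  exact (measurable_finite_hit hX (@closed_region_levels a)).
pose V := [set \sum_i a i | a in admissible p K].
have hV : has_sup V.
  split.
    exists 0, (fun=> 0); last by rewrite big1.
    move=> i; split => //; first by rewrite lexx.
    rewrite (_ : stops_at _ _ = set0) ?measure0 ?lee_fin//.
    apply/seteqP; split => // w [/hit_lty[t t0 [b [j [_ t1 _]]]]].
    by move: t1; rewrite leNgt t0.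
  exists (\sum_(i : I) K) => _ [a adm <-]; apply: ler_sum => i _.
  by have [/andP[]] := adm i.
have /choice[a Ha] : forall n, exists a, admissible p K a /\
    sup V - n.+1%:R^-1 < \sum_i a i.
  move=> n; have [|_ [a adm <-] aV] := sup_adherent (eps := n.+1%:R^-1) _ hV.
    by rewrite invr_gt0 ltr0n.
  by exists a.
have [|phi [phin [c ac]]] := real_selection (K := K) (a := a).
  by move=> n i; have [/(_ i)[]] := Ha n.
have admc : admissible p K c.
  by apply: (admissible_limit (a := fun n => a (phi n))) => // n; have [] := Ha (phi n).
(* The sup is attained along the selected subsequence. *)
have max_c c' : admissible p K c' -> \sum_i c' i <= \sum_i c i.
  move=> adm'; apply: (@le_trans _ _ (sup V)).
    by apply: ub_le_sup; [exact: hV.2|exists c'].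
  have cv : (\sum_i a (phi n) i) @[n --> \oo] --> \sum_i c i.
    by apply: cvg_big => // -[x y]; exact: add_continuous.
  rewrite -(cvg_lim _ cv)//; apply/ler_addgt0Pr => r r0; rewrite -lerBlDr.
  apply: limr_ge; first by apply/cvg_ex; eexists; exact: cv.
  have := near_infty_natSinv_lt (PosNum r0); apply: filterS => n /= nr.
  have [_ /ltW] := Ha (phi n); apply: le_trans; rewrite lerB// (le_trans _ (ltW nr))//.
  by rewrite lef_pV2 ?posrE ?ltr0n// ler_nat ltnS.
exists c; split => [i|i|i|]; [by have [/andP[]] := admc i|
  by have [] := admc i|by have [] := admc i|].
have [eqp|/existsNP[i neqp]] := pselect (forall i, ((p i)%:E <= P 0 (stops_at c i))%E).
  left; apply: (@le_trans _ _ (\sum_i P 0 (stops_at c i))%E); first exact: lee_sum.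
  have <- := prob_disjoint_union (P 0) xpredT (mS c).
    apply: le_measure; rewrite ?inE//; last by move=> w [i _ []].
    exact: measurable_finite_union.
  by move=> i j w [_ Xi] [_ Xj]; apply: pt_inj; rewrite -Xi -Xj.
right; have [ciK pci Pci] := admc i.
have [ciK'|ciK'] := eqVneq (c i) K.
  apply: le_trans (HK i) _; apply: le_measure; rewrite ?inE//.
    exact (markov_measurable hX K (markov_hit hX (@closed_level _ (pt i)))).
  move=> w /hit_lt[t /andP[t0 tK] Xt]; apply/hit_lty; exists t => //.
  exists (s i), i; split => //; first by rewrite ciK' ltW.
  by rewrite Xt /point sideK.
exfalso; apply: (neqp).
have {ciK'}ciK : c i < K by rewrite lt_neqAle ciK'; case/andP: ciK.
pose g n j := c j + (j == i)%:R * n.+1%:R^-1.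
have gi n : g n i = c i + n.+1%:R^-1 by rewrite /g eqxx mul1r.
have gj n j : j != i -> g n j = c j by move=> /negbTE ji; rewrite /g ji mul0r addr0.
have n0 n : 0 < n.+1%:R^-1 :> R by rewrite invr_gt0 ltr0n.
have gc j : g n j @[n --> \oo] --> c j.
  apply/cvgrPdist_lt => r r0; have := near_infty_natSinv_lt (PosNum r0).
  apply: filterS => n /= nr; have [->|ji] := eqVneq j i.
    by rewrite gi opprD addrA subrr sub0r normrN gtr0_norm.
  by rewrite gj// subrr normr0.
have nadm n : ~ admissible p K (g n).
  move=> /max_c; rewrite (bigD1 i)//= [leRHS](bigD1 i)//= gi.
  rewrite (eq_bigr c); last by move=> j; exact: gj.
  by rewrite lerD2r gerDl leNgt n0.
have gK n j : g n j <= K + 1.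
  have [/andP[_ cjK] _ _] := admc j; have [->|ji] := eqVneq j i.
    by rewrite gi lerD ?(ltW ciK)// invf_le1 ?ltr0n// ler1n.
  by rewrite gj// (le_trans cjK)// lerDl.
have : (P 0 (~` stops_at c i) <= (1 - p i)%:E)%E.
  apply: (le_prob_eventually (B := fun n => ~` stops_at (g n) i)).
  - exact: measurableC.
  - by move=> n; exact: measurableC.
  - by apply: filterS (stops_at_eventually_not gc gK) => w H; exact: H.
  have Kc0 : 0 < K - c i by rewrite subr_gt0.
  have := near_infty_natSinv_lt (PosNum Kc0); apply: filterS => n /= nK.
  rewrite probability_setC// EFinB; apply: leeB => //; apply/ltW.
  rewrite ltNge; apply/negP => Pg; apply: (nadm n) => j.
  have [/andP[cj0 cjK] pj Pcj] := admc j; have [ji|ji] := eqVneq j i.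
    rewrite ji in cj0 *; rewrite gi; split => //.
    - by rewrite addr_ge0 ?(ltW (n0 n))//= -lerBrDl ltW.
    - move=> pi0; exfalso; apply: neqp; by rewrite pi0 measure_ge0.
  rewrite gj//; split => //; first by rewrite cj0.
  apply: le_trans Pcj; apply: le_prob_as => //.
  apply: filterS (start_as hX 0) => w X0.
  apply: (@stops_at_lower c (g n) i) => //; first by move=> k; exact: gj.
  by rewrite gi lerDl ltW.
rewrite probability_setC//.
have fS : P 0 (stops_at c i) \is a fin_num by exact: fin_num_measure.
by rewrite -(fineK fS) -EFinB !lee_fin; lra.
Qed.

End finitely_many_levels.

(** * Selection of barriers and discretisation *)

Section helly.
Context {R : realType}.

(** Helly selection for barriers.  Along a subsequence, membership of each
    rational point stabilises; the limit contains a point when the rational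
    points that are strictly earlier and strictly higher are eventually
    members. *)
Lemma barrier_selection (V : nat -> bool -> R -> R -> Prop) :
  (forall n b, barrier (V n b)) -> exists phi U,
  [/\ forall n : nat, (n <= phi n)%N, forall b : bool, barrier (U b),
      forall b, barrier_cvg (fun n => V (phi n) b) (U b) &
      forall b, (forall n t x, 0 < t -> ~ V n b t x) ->
        forall t x, 0 < t -> ~ U b t x].
Proof.
move=> bV.
have [phi [phin sel]] := bool_selection (fun n (k : bool * (rat * rat)) =>
  `[< V n k.1 (ratr k.2.1) (ratr k.2.2) >]).
pose U (b : bool) (t x : R) := 0 <= x /\
  forall q r : rat, 0 < (ratr q : R) -> ratr q < t ->
  x < ratr r -> \forall n \near \oo, V (phi n) b (ratr q) (ratr r).
have notU (b : bool) (t x : R) : 0 <= x -> ~ U b t x -> exists q r : rat,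
    [/\ 0 < (ratr q : R), ratr q < t, x < ratr r &
      \forall n \near \oo, ~ V (phi n) b (ratr q) (ratr r)].
  move=> x0 /not_andP[//|/existsNP[q /existsNP[r]]].
  move=> /not_implyP[q0 /not_implyP[qt /not_implyP[xr nV]]].
  exists q, r; split => //; have [v Hv] := sel (b, (q, r)); case: v Hv => /= Hv.
    by exfalso; apply: nV; apply: filterS Hv => n /asboolP.
  by apply: filterS Hv => n /asboolP.
have cU (b : bool) (t x : R) : 0 < t -> ~ U b t x ->
    \forall p \near (t, x) & n \near \oo, ~ V (phi n) b p.1 p.2.
  move=> t0; have [x0|x0] := leP 0 x; last first.
    move=> _; exists ([set p | p.2 < 0], setT); last first.
      by move=> [[u v] n] [/= v0 _] /(barrier_ge0 (bV _ _)); rewrite leNgt v0.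
    split; last exact: filterT.
    exists (setT, [set v | v < 0]); last by move=> [u v] [].
    by split; [exact: filterT|exact: lt_nbhsl].
  move=> /(notU _ _ _ x0)[q [r [q0 qt xr nV]]].
  exists ([set p | ratr q < p.1 /\ p.2 < ratr r],
          [set n | ~ V (phi n) b (ratr q) (ratr r)]); last first.
    move=> [[u v] n] [/= [qu vr]] nVn Vn; apply: nVn.
    exact: (barrier_mono (bV _ _) q0 (ltW qu) (ltW vr) Vn).
  split => //; exists ([set u | ratr q < u], [set v | v < ratr r]).
    by split; [exact: lt_nbhsr|exact: lt_nbhsl].
  by move=> [u v] [].
have rat_pos (t : R) : 0 < t -> exists q : rat, 0 < (ratr q : R) /\ ratr q < t.
  by move=> /rat_in_itvoo[q]; rewrite in_itv /= => /andP[? ?]; exists q.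
exists phi, U; split => // [b|b|b nV t x t0 [x0 Vx]].
- split => [s t x y s0 st xy [x0 Vx]|t x t0 nU|t x []//].
    split => [|q r q0 qs yr]; first exact: le_trans xy.
    by apply: Vx => //; [exact: lt_le_trans st|exact: le_lt_trans yr].
  have [x0|x0] := leP 0 x; last first.
    exists (setT, [set v | v < 0]);
      last by move=> [u v] [_ /= v0] []; rewrite leNgt v0.
    by split; [exact: filterT|exact: lt_nbhsl].
  have [q [r [q0 qt xr nV]]] := notU _ _ _ x0 nU.
  exists ([set u | ratr q < u], [set v | v < ratr r]).
    by split; [exact: lt_nbhsr|exact: lt_nbhsl].
  move=> [u v] [/= qu vr] [_ /(_ q r q0 qu vr) Vn].
  have /filter_ex[n []//] : \forall n \near \oo,
    ~ V (phi n) b (ratr q) (ratr r) /\ V (phi n) b (ratr q) (ratr r).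
  exact: filterI.
- split => [s t x y [x0 Vx] s0 st xy|t x]; last exact: cU.
  have /rat_in_itvoo[q] := st; rewrite in_itv /= => /andP[sq qt].
  have /rat_in_itvoo[r] := xy; rewrite in_itv /= => /andP[xr ry].
  have := Vx q r (lt_trans s0 sq) qt xr; apply: filterS => n.
  exact: (barrier_mono (bV _ _) s0 (ltW sq) (ltW ry)).
- have [q [q0 qt]] := rat_pos t t0.
  have /rat_in_itvoo[r] : x < x + 1 by rewrite ltrDl.
  rewrite in_itv /= => /andP[xr _].
  by have /filter_ex[n /nV] := Vx q r q0 qt xr; apply.
Qed.

End helly.

Section discretisation.
Context {R : realType} {d : measure_display} {T : measurableType d}
  {P : R -> probability T R} {X : R -> T -> R} (hX : diffusion P X)
  (rX : recurrent P X) (mu : probability (measurableTypeR R) R)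
  (mu0 : mu [set 0] = 0%E).

Lemma measurable_near (K : R) : measurable [set x : measurableTypeR R | `|x| <= K].
Proof.
rewrite (_ : [set _ | _] = `[- K, K]%classic); first exact: measurable_itv.
by apply/seteqP; split => x /=; rewrite in_itv /= ler_norml.
Qed.

Lemma measurable_far (K : R) : measurable [set x : measurableTypeR R | K < `|x|].
Proof.
rewrite (_ : [set _ | _] = ~` [set x | `|x| <= K]).
  by apply: measurableC; exact: measurable_near.
by apply/seteqP; split => x /=; rewrite ltNge => /negP//.
Qed.

Lemma measurable_side b : measurable [set x : measurableTypeR R | (0 < side b x)%R].
Proof. by apply: open_measurable; rewrite openE => x /= ; exact: side_gt_nbhs. Qed.

Section mesh.
Variable m : nat.
Local Notation M := m.+1.
Local Notation I := (bool * 'I_(M * M))%type.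

Let lev (i : I) : R := (i.2 : nat).+1%:R / M%:R.
Let cell (i : I) : set R :=
  [set x | (i.2 : nat)%:R / M%:R < side i.1 x <= lev i].

Let M0 : 0 < M%:R :> R. Proof. by rewrite ltr0n. Qed.

Let lev0 i : 0 < lev i. Proof. by rewrite divr_gt0// ltr0n. Qed.

Let pt_inj : injective (point (fun i : I => i.1) lev).
Proof.
move=> [b i] [c j] E; have bc : b = c.
  move: E; rewrite /point /=; case: b; case: c => //= E.
    by have := lev0 (true, i); rewrite E oppr_gt0 ltNge ltW.
  by have := lev0 (true, j); rewrite -E oppr_gt0 ltNge ltW.
rewrite bc in E *; congr (_, _); apply: val_inj => /=.
have := congr1 (side c) E; rewrite /point !sideK /lev /=.
move=> /(mulIf (invr_neq0 (lt0r_neq0 M0))) /eqP.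
by rewrite eqr_nat eqSS => /eqP.
Qed.

Let cell_gt0 i x : cell i x -> 0 < side i.1 x.
Proof. by move=> /andP[+ _]; apply: le_lt_trans; rewrite divr_ge0. Qed.

Let cell_inj i j x : cell i x -> cell j x -> i = j.
Proof.
case: i => b i; case: j => c j xi xj; have bc : b = c.
  have := cell_gt0 xi; have := cell_gt0 xj; case: (b); case: (c) => //=; lra.
move: xi xj; rewrite bc => /andP[/= ix xi] /andP[/= jx xj].
have := lt_le_trans ix xj; have := lt_le_trans jx xi.
rewrite /lev /= !ltr_pM2r ?invr_gt0// !ltr_nat !ltnS => ji ij.
by congr (_, _); apply: val_inj; apply/eqP; rewrite eqn_leq ij.
Qed.

Let measurable_cell i : measurable (cell i : set (measurableTypeR R)).
Proof.
case: i => [[] i]; rewrite /cell /=.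
  rewrite (_ : [set _ | _] = `](i%:R / M%:R), lev (true, i)]%classic).
    exact: measurable_itv.
  by apply/seteqP; split => x /=; rewrite in_itv.
rewrite (_ : [set _ | _] = `[(- lev (false, i)), (- (i%:R / M%:R))[%classic).
  exact: measurable_itv.
by apply/seteqP; split => x /=; rewrite in_itv /= lerNl ltrNr andbC.
Qed.

Let p i := fine (mu (cell i)).

Let pE i : (p i)%:E = mu (cell i).
Proof. by rewrite fineK// fin_num_measure. Qed.

Let cell_near i x : cell i x -> `|point (fun i : I => i.1) lev i - x| <= M%:R^-1.
Proof.
move=> /andP[ix xi]; have : `|lev i - side i.1 x| <= M%:R^-1.
  rewrite ger0_norm ?subr_ge0// lerBlDr -lerBlDl.
  by rewrite (le_trans _ (ltW ix))// /lev -natr1 mulrDl mul1r addrK.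
have flip (u y r : R) : `|u - (- y)| <= r -> `|- u - y| <= r.
  by rewrite opprK -opprD normrN.
by rewrite /point; case: (i.1) => //=; exact: flip.
Qed.

Let cover (x : R) : x != 0 -> `|x| <= M%:R -> exists i, cell i x.
Proof.
move=> x0 xM; pose b := 0 < x; have bx : side b x = `|x|.
  rewrite /b; have [x_gt0|x_le0] := ltP 0 x; first by rewrite /= gtr0_norm.
  by rewrite /= ler0_norm.
have : exists k, `|x| <= k%:R / M%:R.
  by exists (M * M)%N; rewrite natrM mulfK// lt0r_neq0.
move=> /ex_minnP[[|k] xk kmin].
  by move: xk; rewrite mul0r normr_le0 (negbTE x0).
have kM : (k < M * M)%N by apply: kmin; rewrite natrM mulfK// lt0r_neq0.
exists (b, Ordinal kM); rewrite /cell /lev /= bx xk andbT.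
by rewrite ltNge; apply/negP => /kmin; rewrite ltnn.
Qed.

(** The mass of the cell between two consecutive multiples of 1/M is to be
    stopped at its endpoint farther from 0, so that no level is at 0.  The mass
    that is not stopped is accounted for by the points beyond the grid and by
    the error of [sub_embedding]. *)
Lemma mesh_embedding : exists V : bool -> R -> R -> Prop,
  [/\ forall b, barrier (V b),
   forall A A' : set (measurableTypeR R), measurable A -> measurable A' ->
     (forall x y, A x -> `|x - y| <= M%:R^-1 -> A' y) ->
     (P 0%R (finite_time (first_time X (region V)) `&`
        stopped X (first_time X (region V)) @^-1` A) <= mu A')%E,
   (P 0%R (~` finite_time (first_time X (region V))) <=
      mu [set x | (M%:R < `|x|)%R] + (M%:R^-1)%:E)%E &
   forall b, mu [set x | (0 < side b x)%R] = 0%E ->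
     forall t x, 0 < t -> ~ V b t x].
Proof.
have p0 i : 0 <= p i by rewrite fine_ge0.
have e0 : 0 < M%:R^-1 :> R by rewrite invr_gt0.
have [a [a0 pa0 mass fin]] := sub_embedding hX rX lev0 pt_inj p0 e0.
exists (levels (fun i : I => i.1) lev a).
set tau := first_time X _ in fin *.
have clD := closed_region_levels (s := fun i : I => i.1) lev0 (a := a).
have mfin : measurable (finite_time tau) := measurable_finite_hit hX clD.
split => [b|A A' mA mA' AA'||b mub t x t0 [i [ib ti lx]]].
- exact: barrier_levels.
- pose Q i := `[< A (point (fun i : I => i.1) lev i) >].
  have mS i := measurable_stops_at hX (fun i : I => i.1) lev0 a i.
  apply: (@le_trans _ _ (P 0 [set w | exists2 i, Q i &
     stops_at (X := X) (fun i : I => i.1) lev a i w])).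
    apply: le_prob_as.
    + exact (measurable_stopped_hit hX clD mA).
    + exact: measurable_finite_union.
    apply: filterS (start_as hX 0) => w X0 [fw Aw].
    have [i [_ si]] := stops_at_some hX lev0 X0 fw; exists i => //.
    by apply/asboolP; case: si => _ <-.
  apply: (le_trans (prob_finite_union_le _ _ mS)).
  apply: (@le_trans _ _ (\sum_(i | Q i) mu (cell i))%E).
    by apply: lee_sum => i _; rewrite -pE.
  rewrite -(prob_disjoint_union _ Q measurable_cell cell_inj).
  apply: le_measure; rewrite ?inE//; first exact: measurable_finite_union.
  by move=> x [i /asboolP Ai /cell_near]; exact: AA'.
- have mtail := measurable_far M%:R.
  have cov : (1 <= mu [set x | (M%:R < `|x|)%R] + \sum_i (p i)%:E)%E.
    rewrite (eq_bigr (fun i => mu (cell i))); last by move=> i _; exact: pE.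
    rewrite -(prob_disjoint_union _ xpredT measurable_cell cell_inj).
    pose far := [set x : measurableTypeR R | M%:R < `|x|].
    pose cells := [set x : measurableTypeR R | exists2 i, xpredT i & cell i x].
    have mU : measurable cells by exact: measurable_finite_union.
    have mTU : measurable (far `|` cells) by exact: measurableU.
    apply: le_trans (measureU2 _ mtail mU).
    rewrite -(probability_setT mu).
    apply: (@le_trans _ _ (mu [set 0%R] + mu (far `|` cells))%E).
      have m1 : measurable ([set 0%R] : set (measurableTypeR R)) by exact: measurable_set1.
      apply: le_trans (measureU2 _ m1 mTU).
      apply: le_measure; rewrite ?inE//; first exact: measurableU.
      move=> x _; have [->|x0] := eqVneq x 0; first by left.
      right; have [xM|?] := leP `|x| M%:R; [right|by left].
      by have [i ci] := cover x0 xM; exists i.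
    by rewrite mu0 add0e.
  rewrite probability_setC//.
  have ft : mu [set x | (M%:R < `|x|)%R] \is a fin_num by exact: fin_num_measure.
  have fF : P 0 (finite_time tau) \is a fin_num by exact: fin_num_measure.
  move: cov fin; rewrite -(fineK ft) -(fineK fF) sumEFin -!EFinD !lee_fin.
  have : 0 <= fine (mu [set x | (M%:R < `|x|)%R]) by rewrite fine_ge0.
  move: (fine (mu _)) (fine (P 0 _)) (\sum_i p i) (M%:R^-1) e0 => f F S e e0 f0 cov.
  by move=> [|]; lra.
- have : p i = 0.
    have : (mu (cell i) <= 0)%E.
      rewrite -mub; apply: le_measure; rewrite ?inE;
        [exact: measurable_cell|exact: measurable_side|].
      by move=> y /cell_gt0; rewrite ib.
    by rewrite -pE lee_fin => pi0; apply/eqP; rewrite eq_le pi0 p0.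
  by move=> /pa0 ai0; move: ti; rewrite ai0 leNgt t0.
Qed.

End mesh.
End discretisation.

(** * Passage to the limit *)

Section embedding.
Context {R : realType} {d : measure_display} {T : measurableType d}
  {P : R -> probability T R} {X : R -> T -> R} (hX : diffusion P X)
  (rX : recurrent P X) (mu : probability (measurableTypeR R) R)
  (mu0 : mu [set 0] = 0%E).

Lemma no_mass_near0 (r : R) : 0 < r ->
  exists2 e, 0 < e & (mu [set x | (`|x| <= 2 * e)%R] <= r%:E)%E.
Proof.
move=> r0; pose A n := [set x : measurableTypeR R | `|x| <= 2 * n.+1%:R^-1] `\ 0.
have mA n : measurable (A n).
  by apply: measurableD; [exact: measurable_near|exact: measurable_set1].
have [|n An] := prob_vanish mu mA _ r0.
  move=> x; have [->|x0] := eqVneq x 0; first by apply: nearW => n [_]; apply.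
  have x0' : 0 < `|x| / 2 by rewrite divr_gt0// normr_gt0.
  have := near_infty_natSinv_lt (PosNum x0'); apply: filterS => n /= nx [/= xn _].
  move: (n.+1%:R^-1) nx xn => u nx xn; lra.
exists n.+1%:R^-1; first by rewrite invr_gt0 ltr0n.
have m0 : measurable ([set 0%R] : set (measurableTypeR R)) by exact: measurable_set1.
apply: (@le_trans _ _ (mu (A n) + mu [set 0%R])%E); last by rewrite mu0 adde0.
apply: le_trans (measureU2 _ (mA n) m0).
apply: le_measure; rewrite ?inE; [exact: measurable_near|exact: measurableU|].
by move=> x xn; have [->|x0] := eqVneq x 0; [right|left; split => //; apply/eqP].
Qed.

Lemma no_mass_far (r : R) : 0 < r ->
  exists2 K, 0 < K & (mu [set x | (K < `|x|)%R] <= r%:E)%E.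
Proof.
move=> r0; have [||n An] := @prob_vanish _ _ _ mu
    (fun n => [set x | n.+1%:R < `|x|]) r _ _ r0; last by exists n.+1%:R.
  by move=> n; exact: measurable_far.
move=> x; exists (Num.bound `|x|) => // n /= xn; apply/negP; rewrite -leNgt.
apply: le_trans (ltW (archi_boundP (normr_ge0 x))) _.
by rewrite ler_nat (leq_trans xn).
Qed.

Section limit.
Variables (V : nat -> bool -> R -> R -> Prop) (U : bool -> R -> R -> Prop).
Hypotheses (bV : forall n b, barrier (V n b)) (bU : forall b, barrier (U b)).
Hypothesis VU : forall b, barrier_cvg (fun n => V n b) (U b).

Let sigma n := first_time X (region (V n)).
Let tau := first_time X (region U).

Hypothesis finV : forall r : R, 0 < r ->
  \forall n \near \oo, (P 0 (~` finite_time (sigma n)) <= r%:E)%E.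
Hypothesis massV : forall (r : R) (A A' : set (measurableTypeR R)), 0 < r ->
  measurable A -> measurable A' -> (forall x y, A x -> `|x - y| <= r -> A' y) ->
  \forall n \near \oo, (P 0 (finite_time (sigma n) `&`
     stopped X (sigma n) @^-1` A) <= mu A')%E.

Let clU := closed_regionU bU.
Let clV n := closed_regionU (bV n).
Let ent := enters_as hX rX bU.

Let mfin : measurable (finite_time tau) := measurable_finite_hit hX clU.

Let mstop (A : set (measurableTypeR R)) : measurable A ->
  measurable (finite_time tau `&` stopped X tau @^-1` A).
Proof. exact (measurable_stopped_hit hX clU). Qed.

Let mfinV n : measurable (finite_time (sigma n)).
Proof. exact (measurable_finite_hit hX (@clV n)). Qed.

Let mstopV n (A : set (measurableTypeR R)) : measurable A ->
  measurable (finite_time (sigma n) `&` stopped X (sigma n) @^-1` A).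
Proof. exact (measurable_stopped_hit hX (@clV n)). Qed.

Let mnear e : measurable [set x : measurableTypeR R | `|x| < e].
Proof.
rewrite (_ : [set _ | _] = `]- e, e[%classic); first exact: measurable_itv.
by apply/seteqP; split => x /=; rewrite in_itv /= ltr_norml.
Qed.

(** If one of the barriers stays below a level [K], that level is reached by
    recurrence.  Otherwise both barriers of the approximating regions have
    passed [K + 1] at some time [t], so a path that has not stopped by time [t]
    will stop far away, and tightness of [mu] makes this unlikely. *)
Lemma limit_finite : P 0 (~` finite_time tau) = 0%E.
Proof.
(* Either some barrier is bounded, or both pass every level. *)
have [[b Ub]|nU] := pselect
  (exists b, exists2 K : R, 0 <= K & forall t, 0 < t -> U b t K).
  have [K K0 UK] := Ub.
  rewrite probability_setC// (prob1_of_as mfin) ?subee//.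
  apply: filterS (reach_as hX rX 0 (side b K)) => w /hit_lty[t t0 Xt].
  by apply/hit_lty; exists t => //; exists b; rewrite Xt sideK; exact: UK.
apply/eqP; rewrite eq_le measure_ge0 andbT; apply/lee_addgt0Pr => r r0; rewrite add0e.
have r40 : 0 < r / 4 by rewrite divr_gt0.
have [K K0 muK] := no_mass_far r40; have [e e0 mue] := no_mass_near0 r40.
have [t t0 nUt] : exists2 t, 0 < t & forall b, ~ U b t (K + 1).
  have /choice[t Ht] : forall b, exists t, 0 < t /\ ~ U b t (K + 1).
    move=> b; apply: contrapT => H; apply: nU; exists b, (K + 1).
        by rewrite addr_ge0// ltW.
    by move=> t t0; apply: contrapT => nUt; apply: H; exists t.
  exists (Num.max (t true) (t false)) => [|b Ub].
    by rewrite lt_max; have [-> _] := Ht true.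
  have [tb0 nUb] := Ht b; apply: nUb.
  apply: (barrier_mono (bU b) tb0 _ (lexx _) Ub).
  by rewrite le_max; case: (b); rewrite lexx ?orbT.
have nVt : \forall n \near \oo, forall b, ~ V n b t (K + 1).
  apply: filter_forall => b; have [[/= A N] [At NN] AN] := (VU b).2 _ _ t0 (nUt b).
  apply: filterS NN => n Nn; apply: (AN ((t, K + 1), n)); split => //=.
  exact: nbhs_singleton.
pose A : set (measurableTypeR R) := [set x | K + 1 <= `|x|] `|` [set x | `|x| < e].
pose A' : set (measurableTypeR R) := [set x | K < `|x|] `|` [set x | `|x| <= 2 * e].
have mK1 : measurable [set x : measurableTypeR R | K + 1 <= `|x|].
  rewrite (_ : [set _ | _] = ~` [set x | `|x| < K + 1]); first by apply: measurableC.
  by apply/seteqP; split => x /=; rewrite leNgt => /negP.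
have mfar := measurable_far K; have mn := measurable_near (2 * e).
have mA : measurable A by exact: measurableU.
have mA' : measurable A' by exact: measurableU.
have muA' : (mu A' <= (r / 2)%:E)%E.
  apply: (le_trans (measureU2 _ mfar mn)); apply: (le_trans (leeD muK mue)).
  by rewrite -EFinD lee_fin; lra.
apply: (le_prob_eventually (B := fun n => ~` finite_time (sigma n) `|`
   (finite_time (sigma n) `&` stopped X (sigma n) @^-1` A))).
- exact: measurableC.
- by move=> n; apply: measurableU; [exact: measurableC|exact: mstopV].
- apply: filterS2 ent (start_as hX 0) => w ew X0 nfw.
  have tlt : (t%:E < hit (region U) (X ^~ w))%E.
    by rewrite ltNge; apply/negP => ht; apply: nfw; exact: le_lt_trans ht (ltry _).
  apply: filterS2 nVt (hit_limit_gt VU (path_cpath hX w) X0 e0 tlt) => n nV Hn.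
  have [fn|] := pselect (finite_time (sigma n) w); [right|by left].
  split => //; case: Hn => [tn|]; [left|by right].
  have t1 : t < fine (sigma n w) by rewrite -lte_fin -[ltRHS](hit_fine fn).
  have [b Vb] := hit_attained (path_cpath hX w) fn (@clV n _ _ (lt_trans t0 t1)).
  rewrite /= leNgt; apply/negP => Xlt; apply: (nV b).
  apply: (barrier_mono (bV _ _) t0 (ltW t1) _ Vb).
  apply: le_trans (ltW Xlt).
  by case: (b) => /=; rewrite ?ler_norm// -normrN ler_norm.
- have h0 : 0 < Num.min 2^-1 e by rewrite lt_min invr_gt0 ltr0n.
  have AA' (x y : R) : A x -> `|x - y| <= Num.min 2^-1 e -> A' y.
    have tri1 := ler_normB x (x - y); rewrite subKr in tri1.
    have tri2 := lerB_normD x (y - x); rewrite subrKC distrC in tri2.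
    rewrite le_min => -[/= Ax|/= Ax] /andP[]; [left|right]; rewrite /=; lra.
  apply: filterS2 (massV h0 mA mA' AA') (finV r40) => n mn4 H1.
  have mnf : measurable (~` finite_time (sigma n)) by exact: measurableC.
  apply: (le_trans (measureU2 _ mnf (mstopV n mA))).
  apply: (le_trans (leeD H1 (le_trans mn4 muA'))).
  by rewrite -EFinD lee_fin; lra.
Qed.

(** When the limiting position is in the open set [O], the approximating
    positions eventually are in [O] or close to 0, and there is little mass
    close to 0 since [mu] does not charge 0. *)
Lemma limit_open_le (r : R) (O O' : set (measurableTypeR R)) : 0 < r ->
  open (O : set R) -> measurable O' ->
  (forall x y, O x -> `|x - y| <= r -> O' y) ->
  (P 0 (finite_time tau `&` stopped X tau @^-1` O) <= mu O')%E.
Proof.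
move=> r0 oO mO' OO'; apply/lee_addgt0Pr => r' r'0.
have [e e0 mue] := no_mass_near0 r'0.
have mO : measurable O by exact: open_measurable.
pose A : set (measurableTypeR R) := O `|` [set x | `|x| < e].
pose A' : set (measurableTypeR R) := O' `|` [set x | `|x| <= 2 * e].
have mA : measurable A by exact: measurableU.
have mA' : measurable A' by apply: measurableU => //; exact: measurable_near.
apply: (@le_trans _ _ (mu A')); last first.
  have mn := measurable_near (2 * e).
  by apply: (le_trans (measureU2 _ mO' mn)); exact: leeD2l.
apply: (le_prob_eventually (B := fun n => finite_time (sigma n) `&`
     stopped X (sigma n) @^-1` A)).
- exact: mstop.
- by move=> n; exact: mstopV.
- apply: filterS2 ent (start_as hX 0) => w ew X0 [fw Ow].
  have nO : nbhs (stopped X tau w) O by exact: open_nbhs_nbhs.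
  exact: (hit_limit_stopped VU (path_cpath hX w) X0 ew e0 fw nO).
- have re0 : 0 < Num.min r e by rewrite lt_min r0.
  apply: (massV re0) => // x y [Ox|xe]; rewrite le_min => /andP[xyr xye].
    by left; exact: OO' xyr.
  right; rewrite /= in xe *.
  have := ler_normB x (x - y); rewrite subKr; lra.
Qed.

(** Upper bounds for the mass of both families of open half-lines determine
    the distribution function. *)
Lemma limit_law : forall A : set (measurableTypeR R), measurable A ->
  P 0 (finite_time tau `&` stopped X tau @^-1` A) = mu A.
Proof.
have Pfin : P 0 (finite_time tau) = 1%E.
  have f1 : P 0 (finite_time tau) \is a fin_num by exact: fin_num_measure.
  move: limit_finite; rewrite probability_setC// -(fineK f1) -EFinB => -[]/eqP.
  by rewrite subr_eq0 => /eqP <-.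
pose N (A : set (measurableTypeR R)) := P 0 (finite_time tau `&` stopped X tau @^-1` A).
have NC A : measurable A -> N (~` A) = (1 - N A)%E.
  move=> mA; have mB := mstop mA.
  pose B := finite_time tau `&` stopped X tau @^-1` A.
  have -> : N (~` A) = P 0 (finite_time tau `\` B).
    rewrite /N; congr (P 0 _); apply/seteqP; split => w [fw Xw]; split => //.
      by move=> [_] /Xw.
    by move=> Aw; apply: Xw.
  have -> : P 0 (finite_time tau `\` B) = (P 0 (finite_time tau) - P 0 B)%E.
    rewrite measureD//; last by rewrite (le_lt_trans (probability_le1 _ _))// ltry.
    by rewrite (setIidr (@subIsetl _ _ _)).
  by rewrite Pfin.
have lt_le b (a : R) :
    (N [set x | (side b x < a)%R] <= mu [set x | (side b x < a)%R])%E.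
  have mlt c : measurable [set x : measurableTypeR R | (side b x < c)%R].
    by apply: open_measurable; rewrite openE => x /=; exact: side_lt_nbhs.
  have n0 n : 0 < n.+1%:R^-1 :> R by rewrite invr_gt0 ltr0n.
  apply: (le_prob_eventually (B := fun n => finite_time tau `&`
      stopped X tau @^-1` [set x | side b x < a - n.+1%:R^-1])).
  - exact: mstop.
  - by move=> n; exact: mstop.
  - apply: aeW => w [fw Xa].
    have Xa' : 0 < a - side b (stopped X tau w) by rewrite subr_gt0.
    have := near_infty_natSinv_lt (PosNum Xa'); apply: filterS => n /= nX.
    by split => //=; rewrite ltrBrDl -ltrBrDr.
  - apply: nearW => n; apply: (limit_open_le (n0 n)) => //.
      by rewrite openE => x xa; exact (side_lt_nbhs xa).
    move=> x y /= xa xy; have : side b y <= side b x + `|x - y|.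
      rewrite -lerBlDl; case: (b) => /=; first by rewrite distrC ler_norm.
      by rewrite opprK addrC ler_norm.
    by move: (n.+1%:R^-1) xa xy => u xa xy; lra.
(* Lower half-lines bound the complement, which gives the converse inequality. *)
have gtE (a : R) : N `]a, +oo[%classic = mu `]a, +oo[%classic.
  have gtF c : `]c, +oo[%classic = [set x | side false x < - c] :> set R.
    by apply/seteqP; split => x /=; rewrite in_itv /= andbT ltrN2.
  apply/eqP; rewrite eq_le; apply/andP; split; first by rewrite gtF; exact: lt_le.
  have mlt c : measurable [set x : measurableTypeR R | (side true x < c)%R].
    by apply: open_measurable; rewrite openE => x xc; exact (side_lt_nbhs xc).
  have mgt : measurable (`]a, +oo[%classic : set (measurableTypeR R)).
    exact: measurable_itv.
  have n0 n : 0 < n.+1%:R^-1 :> R by rewrite invr_gt0 ltr0n.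
  apply: (le_prob_eventually (B := fun n : nat =>
    ~` [set x : measurableTypeR R | side true x < a + n.+1%:R^-1])) => //.
  - by move=> n; exact: measurableC.
  - apply: aeW => x /=; rewrite in_itv /= andbT => ax.
    have ax' : 0 < x - a by rewrite subr_gt0.
    have := near_infty_natSinv_lt (PosNum ax'); apply: filterS => n /= nx.
    by apply/negP; rewrite -leNgt -lerBrDl ltW.
  - apply: nearW => n; rewrite probability_setC//.
    apply: (@le_trans _ _ (1 - N [set x | (side true x < a + n.+1%:R^-1)%R])%E).
      by apply: leeB => //; exact: lt_le.
    rewrite -NC//; apply: le_measure; rewrite ?inE;
      [by apply: mstop; exact: measurableC|exact: mstop|].
    move=> w [fw /negP]; rewrite -leNgt => /= ax; split => //=.
    by rewrite in_itv /= andbT (lt_le_trans _ ax)// ltrDl.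
have gen (A : set (measurableTypeR R)) :
    measurable A -> (@RGenOInfty.G R).-sigma.-measurable A.
  by rewrite -RGenOInfty.measurableE.
move=> A /gen; apply: (@dynkin_induction _ (measurableTypeR R) (@RGenOInfty.G R)
  (fun A => N A = mu A) (RGenOInfty.measurableE R)).
- move=> _ _ [x ->] [y ->]; exists (Num.max x y).
  apply/seteqP; split => z /=; rewrite !in_itv /= !andbT gt_max.
    by move=> [-> ->].
  by move=> /andP.
- by rewrite /N preimage_setT setIT Pfin probability_setT.
- by move=> _ [a ->]; exact: gtE.
- by move=> S mS NS; rewrite NC// NS probability_setC.
- move=> F mF tF NF; rewrite /N preimage_bigcup setI_bigcupr !measure_bigcup//.
  + by apply: eq_eseriesr => n _; exact: NF.
  + by move=> n _; exact: mstop.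
  + apply/trivIsetP => i j _ _ ij; apply/seteqP; split => w // [[_ Fi] [_ Fj]].
    have /trivIsetP/(_ i j I I ij) E := tF.
    by have : (F i `&` F j) (stopped X tau w) by []; rewrite E.
Qed.

End limit.

Lemma embedding : exists U : bool -> R -> R -> Prop,
  [/\ forall b, barrier (U b),
   {ae P 0, forall w, finite_time (first_time X (region U)) w},
   forall A : set (measurableTypeR R), measurable A ->
     P 0 (finite_time (first_time X (region U)) `&`
        stopped X (first_time X (region U)) @^-1` A) = mu A &
   forall b, mu [set x | (0 < side b x)%R] = 0%E ->
     forall t x, 0 < t -> ~ U b t x].
Proof.
have /choice[V HV] := mesh_embedding hX rX mu0.
have bV n b : barrier (V n b) by have [] := HV n.
have [phi [U [phin bU VU emptyU]]] := barrier_selection bV.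
have fine_mesh (r : R) : 0 < r -> \forall n \near \oo, (phi n).+1%:R^-1 <= r.
  move=> r0; have := near_infty_natSinv_lt (PosNum r0); apply: filterS => n /= nr.
  rewrite (le_trans _ (ltW nr))// lef_pV2 ?posrE ?ltr0n// ler_nat ltnS.
  exact: phin.
have finV (r : R) : 0 < r -> \forall n \near \oo,
    (P 0%R (~` finite_time (first_time X (region (V (phi n))))) <= r%:E)%E.
  move=> r0; have r20 : 0 < r / 2 by rewrite divr_gt0.
  have [K K0 muK] := no_mass_far r20.
  have farn : \forall n \near \oo, K <= (phi n).+1%:R.
    exists (Num.bound K) => // n /= Kn.
    apply: le_trans (ltW (archi_boundP (ltW K0))) _.
    by rewrite ler_nat (leq_trans Kn)// (leq_trans (phin n)).
  apply: filterS2 (fine_mesh _ r20) farn => n nr Kn.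
  have [_ _ H _] := HV (phi n); apply: (le_trans H).
  rewrite [leRHS](_ : _ = (r / 2)%:E + (r / 2)%:E)%E; last first.
    by rewrite -EFinD; congr (_%:E); lra.
  apply: leeD; last by rewrite lee_fin.
  apply: le_trans muK; apply: le_measure; rewrite ?inE;
    [exact: measurable_far|exact: measurable_far|].
  by move=> x /=; exact: le_lt_trans.
have massV (r : R) (A A' : set (measurableTypeR R)) : 0 < r ->
    measurable A -> measurable A' -> (forall x y, A x -> `|x - y| <= r -> A' y) ->
    \forall n \near \oo, (P 0%R (finite_time (first_time X (region (V (phi n)))) `&`
       stopped X (first_time X (region (V (phi n)))) @^-1` A) <= mu A')%E.
  move=> r0 mA mA' AA'; apply: filterS (fine_mesh r r0) => n nr.
  have [_ H _ _] := HV (phi n); apply: H => // x y Ax xy; apply: (AA' x) => //.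
  exact: le_trans nr.
have bVphi n := bV (phi n).
exists U; split => //; last first.
- move=> b mub; apply: emptyU => n t x t0.
  by have [_ _ _] := HV n; apply.
- move=> A mA; exact: (limit_law bVphi bU VU finV massV mA).
have mfin := measurable_finite_hit hX (closed_regionU bU).
exists (~` finite_time (first_time X (region U))).
split; [exact: measurableC|exact: (limit_finite bVphi bU VU finV massV)|by []].
Qed.

End embedding.

(** * From barriers to boundary functions *)

Section boundary.
Context {R : realType}.
Implicit Types U : R -> R -> Prop.

Definition boundary U (t : R) : \bar R := ereal_inf [set x%:E | x in U t].

Lemma boundary_ge0 U t : barrier U -> (0 <= boundary U t)%E.
Proof.
by move=> bU; apply/ereal_infP => _ [x Ux <-]; rewrite lee_fin (barrier_ge0 bU Ux).
Qed.

(** The infimum is attained because the barrier is closed. *)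
Lemma boundaryP U t x : barrier U -> 0 < t -> U t x <-> (boundary U t <= x%:E)%E.
Proof.
move=> bU t0; split => [Ux|]; first by apply: ereal_inf_lbound; exists x.
move=> le; apply: contrapT => nU.
have [[/= V W] [Vt Wx] VW] := barrier_closed bU t0 nU.
have /nbhs_ballP[e /= e0 He] := Wx.
have nUe : ~ U t (x + e / 2).
  apply: (VW (t, x + e / 2)); split => /=; first exact: nbhs_singleton.
  by apply: He; rewrite /ball /= opprD addrA subrr sub0r normrN gtr0_norm; lra.
suff : ((x + e / 2)%:E <= boundary U t)%E.
  by move=> /le_trans /(_ le); rewrite lee_fin; lra.
apply/ereal_infP => _ [y Uy <-]; rewrite lee_fin leNgt; apply/negP => /ltW yx.
exact/nUe/(barrier_mono bU t0 (lexx _) yx Uy).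
Qed.

Lemma boundary_mono U s t : barrier U -> 0 < s -> s <= t ->
  (boundary U s <= boundary U t)%E.
Proof.
move=> bU s0 st; apply/ereal_infP => _ [x Ux <-]; apply: ereal_inf_lbound.
by exists x => //; exact: (barrier_mono bU s0 st (lexx _) Ux).
Qed.

Lemma boundary_left_continuous U : barrier U -> left_continuous (boundary U).
Proof.
move=> bU t t0.
have lower (a : R) : (a%:E < boundary U t)%E ->
    \forall s \near t^'-, (a%:E <= boundary U s)%E.
  move=> at_; have nU : ~ U t a.
    by rewrite (boundaryP a bU t0) => /(lt_le_trans at_); rewrite ltxx.
  have [[/= V W] [Vt Wa] VW] := barrier_closed bU t0 nU.
  have : \forall s \near t^'-, 0 < s /\ V s.
    apply: filterI; first exact: nbhs_left_gt.
    exact: cvg_within Vt.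
  apply: filterS => s [s0 Vs]; rewrite leNgt; apply/negP => /ltW /(boundaryP a bU s0).
  by apply: (VW (s, a)); split => //=; exact: nbhs_singleton.
have upper : \forall s \near t^'-, (boundary U s <= boundary U t)%E.
  have : \forall s \near t^'-, 0 < s /\ s <= t.
    by apply: filterI; [exact: nbhs_left_gt|exact: nbhs_left_le].
  by apply: filterS => s [s0 st]; exact: boundary_mono.
have ge0 := boundary_ge0 t bU.
case: (boundary U t) ge0 lower upper => [r| |]// ge0 lower upper.
  have fin : \forall s \near t^'-, boundary U s \is a fin_num.
    apply: filterS upper => s sr; rewrite ge0_fin_numE ?boundary_ge0//.
    exact: le_lt_trans sr (ltry _).
  apply/fine_cvgP; split => //; apply/cvgrPdist_le => e e0.
  have re : ((r - e)%:E < r%:E)%E by rewrite lte_fin; lra.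
  apply: filterS3 fin upper (lower _ re) => s fs; rewrite -(fineK fs) !lee_fin /=.
  by move=> ? ?; rewrite ler_distlC; apply/andP; split; lra.
by apply/cvgeyPge => a; apply: lower; exact: ltry.
Qed.

Lemma boundary_increasing U : barrier U -> increasing (boundary U).
Proof.
move=> bU s t; rewrite !in_itv /= !andbT => s0 t0 st; exact: boundary_mono.
Qed.

End boundary.

(** * Embedding the law *)

Section support.
Context {R : realType} (mu : probability (measurableTypeR R) R).

(** The complement of the support is covered by countably many null
    intervals with rational endpoints. *)
Lemma support_null b : topological_support mu `<=` [set x | 0 <= side b x] ->
  mu [set x | (0 < side (~~ b) x)%R] = 0%E.
Proof.
move=> sup; pose F (k : rat * rat) : set (measurableTypeR R) :=
  if `[< mu `](ratr k.1), (ratr k.2)[%classic = 0%E >]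
  then `](ratr k.1), (ratr k.2)[%classic else set0.
have nF : mu.-negligible (\bigcup_n (oapp F set0 (unpickle n))).
  apply: negligible_bigcup => n; case: (unpickle n) => [k|] /=; last exact: negligible_set0.
  rewrite /F; case: ifPn => [/asboolP k0|_]; last exact: negligible_set0.
  by apply/negligibleP => //; exact: measurable_itv.
apply: (measure_negligible (measurable_side (~~ b))).
apply: negligibleS nF => x /= bx.
have nx : ~ topological_support mu x.
  by move=> /sup /=; case: (b) bx => /=; lra.
have [V [oV Vx Vmu]] : exists V : set R, [/\ open V, V x & mu V = 0%E].
  apply: contrapT => H; apply: nx => V oV Vx; rewrite lt_neqAle measure_ge0 andbT.
  by apply/eqP => V0; apply: H; exists V.
have /nbhs_ballP[e /= e0 He] : nbhs x V by exact: open_nbhs_nbhs.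
have /rat_in_itvoo[q1] : x - e < x by rewrite ltrBlDr ltrDl.
have /rat_in_itvoo[q2] : x < x + e by rewrite ltrDl.
rewrite !in_itv /= => /andP[xq2 q2e] /andP[eq1 q1x].
exists (pickle (q1, q2)); first by [].
rewrite pickleK /= /F ifT /=; first by rewrite in_itv /= q1x.
apply/asboolP/eqP; rewrite eq_le measure_ge0 andbT -Vmu.
apply: le_measure; rewrite ?inE; [exact: measurable_itv|exact: open_measurable|].
move=> y /=; rewrite in_itv /= => /andP[q1y yq2]; apply: He.
by rewrite /ball /= ltr_distlC; apply/andP; split; lra.
Qed.

End support.

Section main.
Context {R : realType} {d : measure_display} {T : measurableType d}
  {P : R -> probability T R} {X : R -> T -> R} (hX : diffusion P X)
  (rX : recurrent P X) (mu : probability (measurableTypeR R) R)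
  (mu0 : mu [set 0] = 0%E).

Lemma first_time_eq (D D' : R -> R -> Prop) :
  (forall t x, 0 < t -> D t x <-> D' t x) -> first_time X D = first_time X D'.
Proof.
move=> DD'; apply/funext => w; congr (ereal_inf _).
apply/seteqP; split => _ [t [t0 Dt] <-]; exists t => //; split => //;
  exact/(DD' _ _ t0).
Qed.

(** When one side carries all the mass, the barrier on that side never becomes
    empty: it would otherwise force the process to stop before a fixed time,
    whereas by [nohit_gt0] it may avoid the region for arbitrarily long.  This
    requires a positive hitting time, which holds since [mu] does not charge
    the starting point. *)
Lemma embedding_law : exists U : bool -> R -> R -> Prop,
  [/\ forall b, barrier (U b), stopped_law (P 0) X (first_time X (region U)) mu,
   forall b, mu [set x | (0 < side b x)%R] = 0%E ->
     forall t x, 0 < t -> ~ U b t x &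
   forall b, mu [set x | (0 < side (~~ b) x)%R] = 0%E ->
     forall t, 0 < t -> exists x, U b t x].
Proof.
have [U [bU fin law empty]] := embedding hX rX mu0; have clU := closed_regionU bU.
exists U; split => // [|b mub t t0].
  by split => // A mA; split; [exact (measurable_stopped_hit hX clU mA)|exact: law].
apply/not_existsP => nU; pose tau := first_time X (region U).
have mfin : measurable (finite_time tau) := measurable_finite_hit hX clU.
have mtau := markov_hit hX clU.
have noU c s x : t <= s -> ~ U c s x.
  move=> ts; have s0 : 0 < s by exact: lt_le_trans ts.
  have [-> Us|cb] := eqVneq c b.
    exact: (nU x) (barrier_mono (bU b) t0 ts (lexx _) Us).
  have -> : c = ~~ b by move: cb; case: (c); case: (b).
  exact: empty.
have Z0 : P 0 (finite_time tau `&` stopped X tau @^-1` [set 0]) = 0%E.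
  by rewrite law.
have mZ : measurable (finite_time tau `&` stopped X tau @^-1` [set 0]).
  by apply: (measurable_stopped_hit hX clU); exact: measurable_set1.
have pos : (0 < P 0 [set w | (0 < tau w)%E])%E.
  apply: (@lt_le_trans _ _ (P 0 (~` (finite_time tau `&` stopped X tau @^-1` [set 0])))).
    by rewrite probability_setC// Z0 sube0 lte01.
  apply: le_prob_as; [exact: measurableC|exact (measurable_gt0 hX mtau)|].
  apply: filterS (start_as hX 0) => w X0 /= nZ.
  rewrite lt_neqAle (hit_ge0 _ _) andbT; apply/eqP => tau0; apply: nZ.
  by rewrite /finite_time /stopped /= -tau0.
have := nohit_gt0 hX rX t clU (time_decreasing_region bU) pos.
apply/negP; rewrite -leNgt.
have <- : P 0 (~` finite_time tau) = 0%E.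
  by rewrite probability_setC// (prob1_of_as mfin fin) subee.
apply: le_measure; rewrite ?inE; [|exact: measurableC|].
  exact: (observed_measurable hX (observed_nohit t clU)).
move=> w nohit /hit_lty[s s0 Ds]; apply: nohit; exists s => //.
rewrite s0 leNgt; apply/negP => /ltW ts; case: Ds => c; exact: noU.
Qed.

End main.

Theorem corollary8 (R : realType) (d : measure_display) (T : measurableType d)
    (P : R -> probability T R) (X : R -> T -> R)
    (mu : probability (measurableTypeR R) R)
    (X_diffusion : diffusion P X) (X_recurrent : recurrent P X)
    (mu0 : mu [set 0] = 0%E) :
  [/\ topological_support mu `<=` [set x | 0 <= x] ->
      exists b : R -> R,
        [/\ left_continuous b, increasing b &
            stopped_law (P 0) X (first_time X (fun t x => b t <= x)) mu],
      topological_support mu `<=` [set x | x <= 0] ->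
      exists c : R -> R,
        [/\ left_continuous c, decreasing c &
            stopped_law (P 0) X (first_time X (fun t x => x <= c t)) mu] &
      topological_support mu `&` [set x | 0 <= x] !=set0 ->
      topological_support mu `&` [set x | x <= 0] !=set0 ->
      exists b c : R -> \bar R,
        [/\ left_continuous b /\ increasing b,
            left_continuous c /\ decreasing c,
            forall t, 0 < t -> b t != -oo%E,
            forall t, 0 < t -> c t != +oo%E &
            stopped_law (P 0) X
              (first_time X
                 (fun t x => (b t <= x%:E)%E \/ (x%:E <= c t)%E)) mu]].
Proof.
have [U [bU law empty full]] := embedding_law X_diffusion X_recurrent mu0.
have bdry_fin b : (forall t, 0 < t -> exists x, U b t x) ->
    forall t, 0 < t -> boundary (U b) t = (fine (boundary (U b) t))%:E.
  move=> Ub t t0; rewrite fineK// ge0_fin_numE ?boundary_ge0//.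
  have [x /(boundaryP x (bU b) t0) Ux] := Ub t t0.
  exact: le_lt_trans Ux (ltry _).
have lc b : (forall t, 0 < t -> exists x, U b t x) ->
    left_continuous (fine \o boundary (U b)).
  move=> Ub t t0; apply: fine_cvg; rewrite /= -bdry_fin//.
  exact: boundary_left_continuous.
have inc b : (forall t, 0 < t -> exists x, U b t x) ->
    increasing (fine \o boundary (U b)).
  move=> Ub s t; rewrite !in_itv /= !andbT => s0 t0 st.
  by rewrite -lee_fin -!bdry_fin//; exact: boundary_mono.
split => [supp|supp|_ _].
- have neg : mu [set x | (0 < side false x)%R] = 0%E.
    exact: (support_null (b := true)).
  have Ut := full true neg.
  exists (fine \o boundary (U true)); split; [exact: lc|exact: inc|].
  rewrite (@first_time_eq _ _ _ _ _ (region U))// => t x t0.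
  rewrite -lee_fin /= -bdry_fin//; split.
    by move/(boundaryP x (bU true) t0) => Ux; exists true.
  move=> [[] Ux]; first exact/(boundaryP _ (bU true) t0).
  by case: (empty false neg t (- x) t0).
- have pos : mu [set x | (0 < side true x)%R] = 0%E.
    apply: (support_null (b := false)) => x /supp /=; by rewrite oppr_ge0.
  have Uf := full false pos.
  exists (fun t => - fine (boundary (U false) t)); split.
  + by move=> t t0; apply: cvgN; exact: lc.
  + by move=> s t s0 t0 st; rewrite lerN2; exact: inc.
  rewrite (@first_time_eq _ _ _ _ _ (region U))// => t x t0.
  rewrite lerNr -lee_fin -bdry_fin//; split.
    by move/(boundaryP (- x) (bU false) t0) => Ux; exists false.
  move=> [[] Ux]; last exact/(boundaryP _ (bU false) t0).
  by case: (empty true pos t x t0).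
- exists (boundary (U true)), (fun t => - boundary (U false) t)%E; split.
  + by split; [exact: boundary_left_continuous|exact: boundary_increasing].
  + split => [t t0|s t s0 t0 st].
      by apply: cvgeN; exact: boundary_left_continuous.
    by rewrite leeN2; exact: boundary_increasing.
  + by move=> t t0; rewrite gt_eqF// (lt_le_trans _ (boundary_ge0 t (bU true))).
  + move=> t t0; rewrite lt_eqF// (le_lt_trans _ (ltry 0))// oppe_le0.
    exact: boundary_ge0.
  rewrite (@first_time_eq _ _ _ _ _ (region U))// => t x t0; split.
    move=> [/(boundaryP x (bU true) t0) Ux|]; first by exists true.
    by rewrite leeNr => /(boundaryP (- x) (bU false) t0) Ux; exists false.
  move=> [[] Ux]; first by left; exact/(boundaryP _ (bU true) t0).
  by right; rewrite leeNr; exact/(boundaryP (- x) (bU false) t0).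
Qed.
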